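(* Let $(R,\mathfrak{m})$ be a commutative noetherian local ring, $I$ an ideal of $R$, and $0\to M'\to M\to M''\to 0$ a short exact sequence of artinian $R$-modules. Then there is a long exact sequence of $I$-formal local homology modules $$\cdots\to \mathfrak{F}^I_{i}(M')\to \mathfrak{F}^I_{i}(M)\to \mathfrak{F}^I_{i}(M'')\to \mathfrak{F}^I_{i-1}(M')\to\cdots.$$
   Context: For an $R$-module $N$, $H^{\mathfrak m}_i(N)=\varprojlim_s\operatorname{Tor}^R_i(R/\mathfrak m^s,N)$ is the $i$-th local homology module, and the $i$-th $I$-formal local homology module is $\mathfrak{F}^I_i(M)=\varinjlim_t H^{\mathfrak m}_i(0:_M I^t)$, where $0:_M I^t=\{x\in M:I^tx=0\}$ and the transition maps are induced by inclusions. These modules are $0$ for $i<0$. *)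

(* Defs.v *)
From HB Require Import structures.
From mathcomp Require Import all_boot all_algebra.
From mathcomp Require Import boolp.
From mathcomp Require Import freeg.

Set Implicit Arguments.
Unset Strict Implicit.
Unset Printing Implicit Defensive.

Import GRing.Theory.
Local Open Scope ring_scope.

(* Throughout, R is a commutative ring, an R-module is an [lmodType R], a     *)
(* submodule of U is a [submodClosed U] and an ideal of R is a                *)
(* [submodClosed R^o]. Membership is made boolean with [`[< _ >]] (boolp).    *)

Section Submodules.
Variable R : comNzRingType.

Definition mk_linear (U V : lmodType R) (f : U -> V) (lin_f : linear f) :
  {linear U -> V} := HB.pack f (GRing.isLinear.Build R U V *:%R f lin_f).

Section Closed.
Variable U : lmodType R.

Definition submod_prop (P : U -> Prop) : Prop :=
  P 0 /\ forall a u v, P u -> P v -> P (a *: u + v).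

Lemma submod_prop_closed (P : U -> Prop) :
  submod_prop P -> GRing.submod_closed (fun x : U => `[< P x >] : bool).
Proof.
case=> P0 PD; split=> [|a u v]; first exact/asboolP.
by rewrite !unfold_in => /asboolP Pu /asboolP Pv; apply/asboolP/PD.
Qed.

Definition mk_submod (P : U -> Prop) (hP : submod_prop P) : submodClosed U :=
  HB.pack (fun x : U => `[< P x >] : bool)
    (GRing.isSubmodClosed.Build R U (fun x : U => `[< P x >] : bool)
       (submod_prop_closed hP)).

Lemma mk_submodP (P : U -> Prop) (hP : submod_prop P) x :
  (x \in mk_submod hP) <-> P x.
Proof. by split=> [/asboolP|Px]; last exact/asboolP. Qed.

Lemma fullm_prop : submod_prop (fun _ : U => True).
Proof. by []. Qed.

Definition fullm : submodClosed U := mk_submod fullm_prop.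

Lemma span_prop (P : U -> Prop) :
  submod_prop (fun x => forall S : submodClosed U,
    (forall y, P y -> y \in S) -> x \in S).
Proof.
split=> [S _|a u v hu hv S hS]; first exact: rpred0.
by rewrite rpredD ?rpredZ ?hu ?hv.
Qed.

Definition span (P : U -> Prop) : submodClosed U := mk_submod (span_prop P).

Lemma span_gen (P : U -> Prop) x : P x -> x \in span P.
Proof. by move=> Px; apply/mk_submodP => S; apply. Qed.

Lemma span_min (P : U -> Prop) (S : submodClosed U) :
  (forall y, P y -> y \in S) -> {subset span P <= S}.
Proof. by move=> hS x /mk_submodP; apply. Qed.

End Closed.

Lemma kerl_prop (U V : lmodType R) (f : {linear U -> V}) :
  submod_prop (fun x => f x = 0).
Proof.
by split=> [|a u v fu fv]; rewrite ?linear0 // linearP fu fv scaler0 addr0.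
Qed.

Definition kerl (U V : lmodType R) (f : {linear U -> V}) : submodClosed U :=
  mk_submod (kerl_prop f).

Lemma iml_prop (U V : lmodType R) (f : {linear U -> V}) :
  submod_prop (fun y => exists x, f x = y).
Proof.
split=> [|a _ _ [x <-] [y <-]]; first by exists 0; rewrite linear0.
by exists (a *: x + y); rewrite linearP.
Qed.

Definition iml (U V : lmodType R) (f : {linear U -> V}) : submodClosed V :=
  mk_submod (iml_prop f).

Lemma preim_prop (U V : lmodType R) (f : {linear U -> V}) (S : submodClosed V) :
  submod_prop (fun x => f x \in S).
Proof.
split=> [|a u v fu fv]; first by rewrite linear0 rpred0.
by rewrite linearP rpredD ?rpredZ.
Qed.

Definition preim_submod (U V : lmodType R) (f : {linear U -> V})
  (S : submodClosed V) : submodClosed U := mk_submod (preim_prop f S).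

Section SubType.
Variables (U : lmodType R) (S : submodClosed U).

Definition submod : Type := {x : U | x \in S}.

HB.instance Definition _ := SubChoice.on submod.
HB.instance Definition _ := [SubChoice_isSubLmodule of submod by <:].

Lemma incl_linear : linear (val : submod -> U).
Proof. by move=> a x y; rewrite linearP. Qed.

Definition incl : {linear submod -> U} := mk_linear incl_linear.

End SubType.

Section SubMap.
Variables (U V : lmodType R) (S : submodClosed U) (T : submodClosed V).
Variables (f : {linear U -> V}) (fST : forall x, x \in S -> f x \in T).

Definition sub_fun (x : submod S) : submod T :=
  exist _ (f (val x)) (fST (valP x)).

Lemma sub_fun_linear : linear sub_fun.
Proof. by move=> a x y; apply/val_inj; rewrite /= !linearP. Qed.

Definition sub_map : {linear submod S -> submod T} := mk_linear sub_fun_linear.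

End SubMap.

Section Quot.
Variables (U : lmodType R) (S : submodClosed U).

Lemma submod_zmod_closed : GRing.zmod_closed (fun x : U => x \in S).
Proof.
split=> [|x y Sx Sy]; first exact: rpred0.
by rewrite unfold_in -scaleN1r rpredD ?rpredZ.
Qed.

Definition submod_zmod : zmodClosed U :=
  HB.pack (fun x : U => x \in S)
    (GRing.isZmodClosed.Build U (fun x : U => x \in S) submod_zmod_closed).

Definition quotm : Type := Quotient.quot submod_zmod.

HB.instance Definition _ := GRing.Zmodule.on quotm.

Let pi (x : U) : quotm := (\pi_(Quotient.quot submod_zmod) x)%qT.
Let rep (q : quotm) : U := repr (q : Quotient.quot submod_zmod).

Lemma quot_eq (x y : U) : (pi x = pi y) <-> (x - y \in S).
Proof.
rewrite -[x - y \in S]/(x - y \in submod_zmod) Quotient.idealrBE.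
by split=> /eqP.
Qed.

Let repK q : pi (rep q) = q. Proof. exact: reprK. Qed.
Let piD : {morph pi : x y / x + y}. Proof. exact: raddfD. Qed.

Definition quot_scale (a : R) (q : quotm) : quotm := pi (a *: rep q).

Let quot_scale_pi a x : quot_scale a (pi x) = pi (a *: x).
Proof. by apply/quot_eq; rewrite -scalerBr rpredZ //; apply/quot_eq/repK. Qed.

Lemma quot_scaleA a b q : quot_scale a (quot_scale b q) = quot_scale (a * b) q.
Proof. by rewrite -[q]repK !quot_scale_pi scalerA. Qed.

Lemma quot_scale1 : left_id 1 quot_scale.
Proof. by move=> q; rewrite -[q]repK quot_scale_pi scale1r. Qed.

Lemma quot_scaleDr : right_distributive quot_scale +%R.
Proof.
move=> a p q; rewrite -[p]repK -[q]repK.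
by rewrite -piD !quot_scale_pi -piD scalerDr.
Qed.

Lemma quot_scaleDl q : {morph quot_scale^~ q : a b / a + b}.
Proof. by move=> a b; rewrite -[q]repK !quot_scale_pi -piD scalerDl. Qed.

HB.instance Definition _ := GRing.Zmodule_isLmodule.Build R quotm
  quot_scaleA quot_scale1 quot_scaleDr quot_scaleDl.

Lemma quot_pi_linear : linear pi.
Proof. by move=> a x y; rewrite piD -quot_scale_pi. Qed.

Definition quot_pi : {linear U -> quotm} := mk_linear quot_pi_linear.

Lemma quot_piP (x y : U) : (quot_pi x = quot_pi y) <-> (x - y \in S).
Proof. exact: quot_eq. Qed.

Definition quot_rep (q : quotm) : U := rep q.

Lemma quot_repK q : quot_pi (quot_rep q) = q.
Proof. exact: repK. Qed.

End Quot.

Section QuotMap.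
Variables (U V : lmodType R) (S : submodClosed U) (T : submodClosed V).
Variables (f : {linear U -> V}) (fST : forall x, x \in S -> f x \in T).

Definition quot_fun (q : quotm S) : quotm T := quot_pi T (f (quot_rep q)).

Lemma quot_fun_pi x : quot_fun (quot_pi S x) = quot_pi T (f x).
Proof.
apply/quot_piP; rewrite -linearB /=; apply: fST.
by apply/quot_piP; rewrite quot_repK.
Qed.

Lemma quot_fun_linear : linear quot_fun.
Proof.
move=> a p q; rewrite -[p]quot_repK -[q]quot_repK.
by rewrite -linearP !quot_fun_pi !linearP.
Qed.

Definition quot_map : {linear quotm S -> quotm T} := mk_linear quot_fun_linear.

Lemma quot_mapE x : quot_map (quot_pi S x) = quot_pi T (f x).
Proof. exact: quot_fun_pi. Qed.

End QuotMap.

End Submodules.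

Arguments fullm {R} U.

Section FreeModules.
Variable R : comNzRingType.

Definition freem (X : choiceType) : Type := {freeg X / R}.

HB.instance Definition _ (X : choiceType) := GRing.Lmodule.on (freem X).

Definition freeb (X : choiceType) (x : X) : freem X := << 1 *g x >>.

Lemma freeb_scale (X : choiceType) (a : R) (x : X) :
  a *: freeb x = << a *g x >>.
Proof.
by apply/eqP/freeg_eqP=> y; rewrite coeffZ !coeffU mul1r.
Qed.

Lemma freemE (X : choiceType) (D : freem X) :
  D = \sum_(x <- dom D) coeff x D *: freeb x.
Proof.
by rewrite -[LHS]freeg_sumE; apply: eq_bigr => x _; rewrite freeb_scale.
Qed.

Section Lift.
Variables (X : choiceType) (M : lmodType R) (f : X -> M).

HB.instance Definition _ :=
  GRing.isZmodMorphism.Build {freeg X / R} M (fglift f) (lift_is_additive f).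

Lemma fglift_linear : linear (fglift f : freem X -> M).
Proof.
suff liftZ a D : fglift f (a *: D) = a *: fglift f D.
  by move=> a D E; rewrite -[in RHS]liftZ; exact: raddfD.
have [s ->] : exists s, D = \sum_(p <- s) p.2 *: freeb p.1.
  exists [seq (x, coeff x D) | x <- dom D].
  by rewrite big_map; exact: freemE.
rewrite scaler_sumr 2!raddf_sum scaler_sumr; apply: eq_bigr => p _.
by rewrite scalerA !freeb_scale [LHS]liftU -scalerA; congr (_ *: _);
  exact/esym/liftU.
Qed.

Definition free_lift : {linear freem X -> M} := mk_linear fglift_linear.

Lemma free_liftE x : free_lift (freeb x) = f x.
Proof. by rewrite [LHS]liftU scale1r. Qed.

End Lift.

Lemma free_ext (X : choiceType) (M : lmodType R) (g h : {linear freem X -> M}) :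
  (forall x, g (freeb x) = h (freeb x)) -> g =1 h.
Proof.
move=> gh D; rewrite [D]freemE !linear_sum.
by apply: eq_bigr => x _; rewrite !linearZ /= gh.
Qed.

Section Map.
Variables (X Y : choiceType) (f : X -> Y).

Definition free_map : {linear freem X -> freem Y} :=
  free_lift (fun x => freeb (f x)).

Lemma free_mapE x : free_map (freeb x) = freeb (f x).
Proof. exact: free_liftE. Qed.

End Map.

End FreeModules.

Section Tensor.
Variable R : comNzRingType.

Section Def.
Variables A N : lmodType R.

Local Notation gen a x := (@freeb R (A * N)%type (a, x)).

Inductive tens_rel : freem R (A * N)%type -> Prop :=
| TensDl a b x : tens_rel (gen (a + b) x - gen a x - gen b x)
| TensDr a x y : tens_rel (gen a (x + y) - gen a x - gen a y)
| TensZl r a x : tens_rel (gen (r *: a) x - r *: gen a x)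
| TensZr r a x : tens_rel (gen a (r *: x) - r *: gen a x).

Definition tens : Type := quotm (span tens_rel).

HB.instance Definition _ := GRing.Lmodule.on tens.

Definition tensor (a : A) (x : N) : tens := quot_pi (span tens_rel) (gen a x).

Lemma tensorDl a b x : tensor (a + b) x = tensor a x + tensor b x.
Proof.
rewrite /tensor -linearD; apply/quot_piP.
by rewrite opprD addrA; apply: span_gen; exact: TensDl.
Qed.

Lemma tensorDr a x y : tensor a (x + y) = tensor a x + tensor a y.
Proof.
rewrite /tensor -linearD; apply/quot_piP.
by rewrite opprD addrA; apply: span_gen; exact: TensDr.
Qed.

Lemma tensorZl r a x : tensor (r *: a) x = r *: tensor a x.
Proof.
rewrite /tensor -linearZ; apply/quot_piP.
by apply: span_gen; exact: TensZl.
Qed.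

Lemma tensorZr r a x : tensor a (r *: x) = r *: tensor a x.
Proof.
rewrite /tensor -linearZ; apply/quot_piP.
by apply: span_gen; exact: TensZr.
Qed.

Lemma tens_ext (V : lmodType R) (g h : {linear tens -> V}) :
  (forall a x, g (tensor a x) = h (tensor a x)) -> g =1 h.
Proof.
move=> gh q; rewrite -[q]quot_repK.
apply: (@free_ext _ _ _ (g \o quot_pi _) (h \o quot_pi _)) => -[a x].
exact: gh.
Qed.

End Def.

Section Map.
Variables (A B N P : lmodType R).
Variables (f : {linear A -> B}) (g : {linear N -> P}).

Definition tens_gen_map :
    {linear freem R (A * N)%type -> freem R (B * P)%type} :=
  free_map R (fun u : A * N => (f u.1, g u.2)).

Lemma tens_gen_mapE a x :
  tens_gen_map (@freeb R (A * N)%type (a, x)) =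
  @freeb R (B * P)%type (f a, g x).
Proof. exact: free_mapE. Qed.

Lemma tens_gen_map_rel u :
  u \in span (@tens_rel A N) -> tens_gen_map u \in span (@tens_rel B P).
Proof.
pose S := preim_submod tens_gen_map (span (@tens_rel B P)).
suff /span_min h : forall y, @tens_rel A N y -> y \in S.
  by move=> /h /mk_submodP.
move=> _ [a b x|a x y|r a x|r a x]; apply/mk_submodP; apply: span_gen.
- by rewrite 2!linearB !tens_gen_mapE linearD; exact: TensDl.
- by rewrite 2!linearB !tens_gen_mapE linearD; exact: TensDr.
- rewrite linearB (linearZ_LR tens_gen_map) !tens_gen_mapE (linearZ_LR f).
  exact: TensZl.
- rewrite linearB (linearZ_LR tens_gen_map) !tens_gen_mapE (linearZ_LR g).
  exact: TensZr.
Qed.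

Definition tens_map : {linear tens A N -> tens B P} :=
  quot_map tens_gen_map_rel.

Lemma tens_mapE a x : tens_map (tensor a x) = tensor (f a) (g x).
Proof. by rewrite [LHS]quot_mapE tens_gen_mapE. Qed.

End Map.

Lemma tens_map_square (A A1 A2 A3 N N1 N2 N3 : lmodType R)
    (f1 : {linear A -> A1}) (f2 : {linear A1 -> A3})
    (f3 : {linear A -> A2}) (f4 : {linear A2 -> A3})
    (g1 : {linear N -> N1}) (g2 : {linear N1 -> N3})
    (g3 : {linear N -> N2}) (g4 : {linear N2 -> N3}) :
    (forall a, f2 (f1 a) = f4 (f3 a)) -> (forall x, g2 (g1 x) = g4 (g3 x)) ->
  forall u, tens_map f2 g2 (tens_map f1 g1 u) = tens_map f4 g4 (tens_map f3 g3 u).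
Proof.
move=> hf hg.
apply: (@tens_ext _ _ _ (tens_map f2 g2 \o tens_map f1 g1)
  (tens_map f4 g4 \o tens_map f3 g3)) => a x.
suff: tens_map f2 g2 (tens_map f1 g1 (tensor a x)) =
    tens_map f4 g4 (tens_map f3 g3 (tensor a x)) by [].
by rewrite !tens_mapE hf hg.
Qed.

Lemma tens_map0l (A B N P : lmodType R) (f : {linear A -> B})
    (g : {linear N -> P}) :
  (forall a, f a = 0) -> forall u, tens_map f g u = 0.
Proof.
move=> f0; apply: (@tens_ext _ _ _ (tens_map f g) \0) => a x.
by rewrite tens_mapE f0 -[0 in LHS](scale0r (0 : B)) tensorZl scale0r.
Qed.

End Tensor.

Section Complexes.
Variable R : comNzRingType.

Record complex := Complex {
  cx_obj :> nat -> lmodType R;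
  cx_d : forall n, {linear cx_obj n.+1 -> cx_obj n};
  cx_dd : forall n x, cx_d n (cx_d n.+1 x) = 0 }.

Arguments cx_d : clear implicits.

Record cxmap (C D : complex) := CxMap {
  cxm :> forall n, {linear C n -> D n};
  cxm_d : forall n x, cx_d D n (cxm n.+1 x) = cxm n (cx_d C n x) }.

(* The differential out of degree 0 is zero. *)
Definition cycles (C : complex) (n : nat) : submodClosed (C n) :=
  match n return submodClosed (C n) with
  | 0 => fullm (C 0)
  | n'.+1 => kerl (cx_d C n')
  end.

Definition boundaries (C : complex) (n : nat) : submodClosed (C n) :=
  iml (cx_d C n).

Definition homology (C : complex) (n : nat) : lmodType R :=
  quotm (preim_submod (incl (cycles C n)) (boundaries C n)).

Section Map.
Variables (C D : complex) (f : cxmap C D) (n : nat).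

Lemma cxmap_cycles x : x \in cycles C n -> f n x \in cycles D n.
Proof.
case: n x => [|k] x; first by move=> _; apply/mk_submodP.
move=> /mk_submodP dx; apply/mk_submodP.
by rewrite cxm_d dx linear0.
Qed.

Definition cycles_map : {linear submod (cycles C n) -> submod (cycles D n)} :=
  sub_map cxmap_cycles.

Lemma cxmap_boundaries x :
  x \in preim_submod (incl (cycles C n)) (boundaries C n) ->
  cycles_map x \in preim_submod (incl (cycles D n)) (boundaries D n).
Proof.
move=> /mk_submodP /mk_submodP [y dy]; apply/mk_submodP; apply/mk_submodP.
by exists (f n.+1 y); rewrite cxm_d dy.
Qed.

Definition homology_map : {linear homology C n -> homology D n} :=
  quot_map cxmap_boundaries.

End Map.

Lemma homology_map_square (C C1 C2 D : complex)
    (f1 : cxmap C C1) (f2 : cxmap C1 D) (f3 : cxmap C C2) (f4 : cxmap C2 D) n :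
    (forall x, f2 n (f1 n x) = f4 n (f3 n x)) ->
  forall h, homology_map f2 n (homology_map f1 n h) =
            homology_map f4 n (homology_map f3 n h).
Proof.
move=> hf h; rewrite -[h]quot_repK [homology_map f1 n _]quot_mapE.
rewrite [LHS]quot_mapE [homology_map f3 n _]quot_mapE [RHS]quot_mapE.
by congr (quot_pi _ _); apply/val_inj; exact: hf.
Qed.

End Complexes.

Section Tor.
Variable R : comNzRingType.

(* Tor i A N is the homology of (res A) (x) N, where res A is the functorial  *)
(* free resolution                                                            *)
(*   ... -> R^(syz 2) -> R^(syz 1) -> R^(syz 0) -> A                          *)
(* where syz 0 = A and syz n.+1 is the kernel of R^(syz n) -> syz n.          *)
Definition aug (B : lmodType R) : {linear freem R B -> B} :=
  free_lift (fun b : B => b).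

Fixpoint syz (A : lmodType R) (n : nat) : lmodType R :=
  if n is n'.+1 then submod (kerl (aug (syz A n'))) else A.

Definition res_obj (A : lmodType R) (n : nat) : lmodType R := freem R (syz A n).

Definition res_d (A : lmodType R) n : {linear res_obj A n.+1 -> res_obj A n} :=
  incl (kerl (aug (syz A n))) \o aug (syz A n.+1).

Lemma res_dd A n x : res_d A n (res_d A n.+1 x) = 0.
Proof.
have /mk_submodP h := valP (aug (syz A n.+2) x).
have : val (aug (syz A n.+1) (val (aug (syz A n.+2) x))) = 0.
  by rewrite h linear0.
exact.
Qed.

Lemma aug_surj (B : lmodType R) (b : B) : exists x, aug B x = b.
Proof. by exists (freeb R b); rewrite free_liftE. Qed.

Lemma res_exact0 (A : lmodType R) (x : res_obj A 0) :
  aug A x = 0 -> exists y, res_d A 0 y = x.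
Proof.
move=> hx; have hx' : x \in kerl (aug A) by apply/mk_submodP.
have [y hy] := aug_surj (exist _ x hx' : syz A 1).
by exists y; rewrite -[LHS]/(val (aug (syz A 1) y)) hy.
Qed.

Lemma res_exact (A : lmodType R) n (x : res_obj A n.+1) :
  res_d A n x = 0 -> exists y, res_d A n.+1 y = x.
Proof.
move=> hx; have hx' : x \in kerl (aug (syz A n.+1)).
  by apply/mk_submodP; apply/val_inj; exact: hx.
have [y hy] := aug_surj (exist _ x hx' : syz A n.+2).
by exists y; rewrite -[LHS]/(val (aug (syz A n.+2) y)) hy.
Qed.

Definition res (A : lmodType R) : complex R := Complex (@res_dd A).

Section ResMap.

Lemma aug_nat (A B : lmodType R) (f : {linear A -> B}) x :
  aug B (free_map R f x) = f (aug A x).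
Proof.
apply: (@free_ext R A B (aug B \o free_map R f) (f \o aug A)) => a.
suff: aug B (free_map R f (freeb R a)) = f (aug A (freeb R a)) by [].
by rewrite free_mapE !free_liftE.
Qed.

Lemma aug_ker (A B : lmodType R) (f : {linear A -> B}) x :
  x \in kerl (aug A) -> free_map R f x \in kerl (aug B).
Proof.
by move=> /mk_submodP hx; apply/mk_submodP; rewrite aug_nat hx linear0.
Qed.

Variables (A B : lmodType R) (f : {linear A -> B}).

Fixpoint syz_map (n : nat) : {linear syz A n -> syz B n} :=
  match n return {linear syz A n -> syz B n} with
  | 0 => f
  | n'.+1 => sub_map (@aug_ker _ _ (syz_map n'))
  end.

Definition res_map_obj n : {linear res_obj A n -> res_obj B n} :=
  free_map R (syz_map n).

Lemma res_map_d n (x : res A n.+1) :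
  cx_d (res B) n (res_map_obj n.+1 x) = res_map_obj n (cx_d (res A) n x).
Proof.
have h := congr1 val (aug_nat (syz_map n.+1) x).
exact: h.
Qed.

Definition res_map : cxmap (res A) (res B) := CxMap res_map_d.

End ResMap.

Lemma syz_map_square (A A1 A2 B : lmodType R)
    (f1 : {linear A -> A1}) (f2 : {linear A1 -> B})
    (f3 : {linear A -> A2}) (f4 : {linear A2 -> B}) :
    (forall a, f2 (f1 a) = f4 (f3 a)) ->
  forall n a, syz_map f2 n (syz_map f1 n a) = syz_map f4 n (syz_map f3 n a).
Proof.
move=> hf; elim=> [|n IHn] a; first exact: hf.
apply/val_inj.
apply: (@free_ext R (syz A n) (freem R (syz B n))
  (free_map R (syz_map f2 n) \o free_map R (syz_map f1 n))
  (free_map R (syz_map f4 n) \o free_map R (syz_map f3 n))) => b.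
suff: free_map R (syz_map f2 n) (free_map R (syz_map f1 n) (freeb R b)) =
  free_map R (syz_map f4 n) (free_map R (syz_map f3 n) (freeb R b)) by [].
by rewrite !free_mapE IHn.
Qed.

Lemma res_map_square (A A1 A2 B : lmodType R)
    (f1 : {linear A -> A1}) (f2 : {linear A1 -> B})
    (f3 : {linear A -> A2}) (f4 : {linear A2 -> B}) :
    (forall a, f2 (f1 a) = f4 (f3 a)) ->
  forall n x, res_map f2 n (res_map f1 n x) = res_map f4 n (res_map f3 n x).
Proof.
move=> hf n.
apply: (@free_ext R (syz A n) (freem R (syz B n))
  (free_map R (syz_map f2 n) \o free_map R (syz_map f1 n))
  (free_map R (syz_map f4 n) \o free_map R (syz_map f3 n))) => b.
suff: free_map R (syz_map f2 n) (free_map R (syz_map f1 n) (freeb R b)) =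
  free_map R (syz_map f4 n) (free_map R (syz_map f3 n) (freeb R b)) by [].
by rewrite !free_mapE (syz_map_square hf).
Qed.

Section TensComplex.
Variables (C : complex R) (N : lmodType R).

Definition tens_cx_d n : {linear tens (C n.+1) N -> tens (C n) N} :=
  tens_map (cx_d C n) idfun.

Lemma tens_cx_dd n u : tens_cx_d n (tens_cx_d n.+1 u) = 0.
Proof.
transitivity (tens_map (\0 : {linear C n -> C n}) (idfun : {linear N -> N})
  (tens_map (\0 : {linear C n.+2 -> C n}) (idfun : {linear N -> N}) u)).
  by apply: tens_map_square => // x; exact: cx_dd.
by rewrite tens_map0l.
Qed.

Definition tens_cx : complex R := Complex tens_cx_dd.

End TensComplex.

Section TensComplexMap.
Variables (C D : complex R) (f : cxmap C D).
Variables (N P : lmodType R) (g : {linear N -> P}).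

Lemma tens_cxmap_d n (u : tens_cx C N n.+1) :
  cx_d (tens_cx D P) n (tens_map (f n.+1) g u) =
  tens_map (f n) g (cx_d (tens_cx C N) n u).
Proof. by apply: tens_map_square => // x; exact: cxm_d. Qed.

Definition tens_cxmap : cxmap (tens_cx C N) (tens_cx D P) := CxMap tens_cxmap_d.

End TensComplexMap.

Definition Tor (i : nat) (A N : lmodType R) : lmodType R :=
  homology (tens_cx (res A) N) i.

Definition Tor_map (i : nat) (A B N P : lmodType R) (f : {linear A -> B})
    (g : {linear N -> P}) : {linear Tor i A N -> Tor i B P} :=
  homology_map (tens_cxmap (res_map f) g) i.

Lemma Tor_map_square i (A A1 A2 A3 N N1 N2 N3 : lmodType R)
    (f1 : {linear A -> A1}) (f2 : {linear A1 -> A3})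
    (f3 : {linear A -> A2}) (f4 : {linear A2 -> A3})
    (g1 : {linear N -> N1}) (g2 : {linear N1 -> N3})
    (g3 : {linear N -> N2}) (g4 : {linear N2 -> N3}) :
    (forall a, f2 (f1 a) = f4 (f3 a)) -> (forall x, g2 (g1 x) = g4 (g3 x)) ->
  forall t, Tor_map i f2 g2 (Tor_map i f1 g1 t) =
            Tor_map i f4 g4 (Tor_map i f3 g3 t).
Proof.
move=> hf hg; apply: homology_map_square => u.
by apply: tens_map_square => // x; exact: res_map_square.
Qed.

End Tor.

Section Limits.
Variable R : comNzRingType.

Section Product.
Variable T : nat -> lmodType R.

Definition dprod : Type := forall n, T n.

HB.instance Definition _ := gen_eqMixin dprod.
HB.instance Definition _ := gen_choiceMixin dprod.

Implicit Types x y z : dprod.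

Let add x y : dprod := fun n => x n + y n.
Let opp x : dprod := fun n => - x n.
Let zero : dprod := fun n => 0.
Let scale (a : R) x : dprod := fun n => a *: x n.

Let addA : associative add.
Proof. by move=> x y z; apply: functional_extensionality_dep => n; exact: addrA. Qed.
Let addC : commutative add.
Proof. by move=> x y; apply: functional_extensionality_dep => n; exact: addrC. Qed.
Let add0 : left_id zero add.
Proof. by move=> x; apply: functional_extensionality_dep => n; exact: add0r. Qed.
Let addN : left_inverse zero opp add.
Proof. by move=> x; apply: functional_extensionality_dep => n; exact: addNr. Qed.

HB.instance Definition _ := GRing.isZmodule.Build dprod addA addC add0 addN.

Let scaleA a b x : scale a (scale b x) = scale (a * b) x.
Proof. by apply: functional_extensionality_dep => n; exact: scalerA. Qed.
Let scale1 : left_id 1 scale.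
Proof. by move=> x; apply: functional_extensionality_dep => n; exact: scale1r. Qed.
Let scaleDr : right_distributive scale +%R.
Proof. by move=> a x y; apply: functional_extensionality_dep => n; exact: scalerDr. Qed.
Let scaleDl x : {morph scale^~ x : a b / a + b}.
Proof. by move=> a b; apply: functional_extensionality_dep => n; exact: scalerDl. Qed.

HB.instance Definition _ := GRing.Zmodule_isLmodule.Build R dprod
  scaleA scale1 scaleDr scaleDl.

End Product.

Record invsys := InvSys {
  inv_obj :> nat -> lmodType R;
  inv_tr : forall n, {linear inv_obj n.+1 -> inv_obj n} }.

Arguments inv_tr : clear implicits.

Lemma compatible_prop (X : invsys) :
  submod_prop (fun x : dprod X => forall n, inv_tr X n (x n.+1) = x n).
Proof.
split=> [n|a x y hx hy n]; first exact: linear0.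
by rewrite -[LHS]/(inv_tr X n (a *: x n.+1 + y n.+1)) linearP hx hy.
Qed.

Definition invlim (X : invsys) : lmodType R := submod (mk_submod (compatible_prop X)).

Section InvMap.
Variables (X Y : invsys) (f : forall n, {linear X n -> Y n}).
Hypothesis f_tr : forall n x, f n (inv_tr X n x) = inv_tr Y n (f n.+1 x).

Definition dprod_fun (x : dprod X) : dprod Y := fun n => f n (x n).

Lemma dprod_fun_linear : linear dprod_fun.
Proof.
by move=> a x y; apply: functional_extensionality_dep => n; exact: linearP.
Qed.

Definition dprod_map : {linear dprod X -> dprod Y} := mk_linear dprod_fun_linear.

Lemma compatible_map x :
  x \in mk_submod (compatible_prop X) ->
  dprod_map x \in mk_submod (compatible_prop Y).
Proof.
move=> /mk_submodP hx; apply/mk_submodP => n.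
by rewrite -[LHS]/(inv_tr Y n (f n.+1 (x n.+1))) -f_tr hx.
Qed.

Definition invlim_map : {linear invlim X -> invlim Y} := sub_map compatible_map.

End InvMap.

Record dirsys := DirSys {
  dir_obj :> nat -> lmodType R;
  dir_tr : forall n, {linear dir_obj n -> dir_obj n.+1} }.

Arguments dir_tr : clear implicits.

Section Dirlim.
Variable X : dirsys.

Definition dir_elt : choiceType := {n : nat & X n}.

Local Notation gen n x := (@freeb R dir_elt (existT _ n x)).

(* The direct limit by generators and relations: the relations make the       *)
(* canonical maps X n -> dirlim X linear and compatible with the transition   *)
(* maps.                                                                      *)
Inductive dir_rel : freem R dir_elt -> Prop :=
| DirP n a (x y : X n) : dir_rel (gen n (a *: x + y) - (a *: gen n x + gen n y))
| DirTr n (x : X n) : dir_rel (gen n.+1 (dir_tr X n x) - gen n x).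

Definition dirlim : lmodType R := quotm (span dir_rel).

Definition dir_in n (x : X n) : dirlim := quot_pi (span dir_rel) (gen n x).

Lemma dir_inP n : linear (@dir_in n).
Proof.
move=> a x y; rewrite /dir_in -linearP; apply/quot_piP.
by apply: span_gen; exact: DirP.
Qed.

Lemma dir_in_tr n (x : X n) : dir_in (dir_tr X n x) = dir_in x.
Proof. by apply/quot_piP; apply: span_gen; exact: DirTr. Qed.

End Dirlim.

Section DirMap.
Variables (X Y : dirsys) (f : forall n, {linear X n -> Y n}).
Hypothesis f_tr : forall n x, f n.+1 (dir_tr X n x) = dir_tr Y n (f n x).

Definition dir_gen_map : {linear freem R (dir_elt X) -> freem R (dir_elt Y)} :=
  free_map R (fun u : dir_elt X => existT _ (tag u) (f (tag u) (tagged u))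
                : dir_elt Y).

Lemma dir_gen_mapE n (x : X n) :
  dir_gen_map (@freeb R (dir_elt X) (existT _ n x)) =
  @freeb R (dir_elt Y) (existT _ n (f n x)).
Proof. exact: free_mapE. Qed.

Lemma dir_gen_map_rel u :
  u \in span (@dir_rel X) -> dir_gen_map u \in span (@dir_rel Y).
Proof.
pose S := preim_submod dir_gen_map (span (@dir_rel Y)).
suff /span_min h : forall y, @dir_rel X y -> y \in S.
  by move=> /h /mk_submodP.
move=> _ [n a x y|n x]; apply/mk_submodP; apply: span_gen.
- rewrite linearB (linearP dir_gen_map) !dir_gen_mapE (linearP (f n)).
  exact: DirP.
- rewrite linearB !dir_gen_mapE f_tr.
  exact: DirTr.
Qed.

Definition dirlim_map : {linear dirlim X -> dirlim Y} :=
  quot_map dir_gen_map_rel.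

Lemma dirlim_mapE n (x : X n) : dirlim_map (dir_in x) = dir_in (f n x).
Proof. by rewrite [LHS]quot_mapE dir_gen_mapE. Qed.

End DirMap.

End Limits.

Section Rings.
Variable R : comNzRingType.

Local Notation ideal := (submodClosed R^o).

Definition noetherian_ring : Prop :=
  forall J : ideal, exists s : seq R^o, J =i span (fun x : R^o => x \in s).

Definition maximal_ideal (J : ideal) : Prop :=
  1 \notin J /\
  forall K : ideal, {subset J <= K} -> 1 \notin K -> {subset K <= J}.

Definition local_ring (m : ideal) : Prop :=
  maximal_ideal m /\ forall J : ideal, maximal_ideal J -> J =i m.

Definition ideal_mul (I J : ideal) : ideal :=
  span (fun x : R^o => exists a b : R, [/\ a \in I, b \in J & x = a * b]).

Definition ideal_pow (I : ideal) (n : nat) : ideal :=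
  iter n (ideal_mul I) (fullm R^o).

Lemma ideal_powS (I : ideal) n x : x \in ideal_pow I n.+1 -> x \in ideal_pow I n.
Proof.
apply/span_min => _ [a [b [_ hb ->]]].
by rewrite -[a * b]/(a *: (b : R^o)) rpredZ.
Qed.

Definition artinian (M : lmodType R) : Prop :=
  forall S : nat -> submodClosed M,
    (forall n, {subset S n.+1 <= S n}) ->
  exists n, forall k, (n <= k)%N -> S k =i S n.

End Rings.

Section LocalHomology.
Variables (R : comNzRingType) (m : submodClosed R^o) (i : nat).

Definition quot_pow (s : nat) : lmodType R := quotm (ideal_pow m s).

Definition quot_pow_tr (s : nat) : {linear quot_pow s.+1 -> quot_pow s} :=
  @quot_map R R^o R^o _ _ idfun (@ideal_powS R m s).

Definition local_homology_sys (N : lmodType R) : invsys R :=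
  @InvSys R (fun s => Tor i (quot_pow s) N)
    (fun s => Tor_map i (quot_pow_tr s) idfun).

Definition local_homology (N : lmodType R) : lmodType R :=
  invlim (local_homology_sys N).

Section Map.
Variables (N P : lmodType R) (g : {linear N -> P}).

Definition local_homology_sys_map (s : nat) :
    {linear local_homology_sys N s -> local_homology_sys P s} :=
  Tor_map i (idfun : {linear quot_pow s -> quot_pow s}) g.

Lemma local_homology_sys_map_tr s x :
  local_homology_sys_map s (inv_tr (local_homology_sys N) s x) =
  inv_tr (local_homology_sys P) s (local_homology_sys_map s.+1 x).
Proof. exact: Tor_map_square. Qed.

Definition local_homology_map : {linear local_homology N -> local_homology P} :=
  invlim_map local_homology_sys_map_tr.

End Map.

Lemma local_homology_map_square (N N1 N2 P : lmodType R)
    (g1 : {linear N -> N1}) (g2 : {linear N1 -> P})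
    (g3 : {linear N -> N2}) (g4 : {linear N2 -> P}) :
    (forall x, g2 (g1 x) = g4 (g3 x)) ->
  forall h, local_homology_map g2 (local_homology_map g1 h) =
            local_homology_map g4 (local_homology_map g3 h).
Proof.
move=> hg h; apply/val_inj; apply: functional_extensionality_dep => s.
exact: Tor_map_square.
Qed.

End LocalHomology.

Section FormalLocalHomology.
Variables (R : comNzRingType) (m I : submodClosed R^o).

Lemma ann_prop (M : lmodType R) (J : submodClosed R^o) :
  submod_prop (fun x : M => forall a : R, a \in J -> a *: x = 0).
Proof.
split=> [a _|r x y hx hy a Ja]; first exact: scaler0.
by rewrite scalerDr scalerA mulrC -scalerA hx // hy // scaler0 addr0.
Qed.

(* 0 :_M J *)
Definition ann (M : lmodType R) (J : submodClosed R^o) : submodClosed M :=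
  mk_submod (ann_prop M J).

Lemma ann_powS (M : lmodType R) t (x : M) :
  x \in ann M (ideal_pow I t) -> x \in ann M (ideal_pow I t.+1).
Proof.
move=> /mk_submodP hx; apply/mk_submodP => a Ja.
by apply: hx; exact: ideal_powS.
Qed.

Lemma ann_map (M N : lmodType R) (f : {linear M -> N}) J (x : M) :
  x \in ann M J -> f x \in ann N J.
Proof.
by move=> /mk_submodP hx; apply/mk_submodP => a Ja; rewrite -linearZ hx ?linear0.
Qed.

Definition ann_incl (M : lmodType R) (t : nat) :
    {linear submod (ann M (ideal_pow I t)) ->
            submod (ann M (ideal_pow I t.+1))} :=
  @sub_map R M M _ _ idfun (@ann_powS M t).

Section Nat.
Variable i : nat.

Definition formal_sys (M : lmodType R) : dirsys R :=
  @DirSys R (fun t => local_homology m i (submod (ann M (ideal_pow I t))))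
    (fun t => local_homology_map m i (ann_incl M t)).

Section Map.
Variables (M N : lmodType R) (f : {linear M -> N}).

Definition formal_sys_map (t : nat) : {linear formal_sys M t -> formal_sys N t} :=
  local_homology_map m i (sub_map (@ann_map M N f (ideal_pow I t))).

Lemma formal_sys_map_tr t x :
  formal_sys_map t.+1 (dir_tr (formal_sys M) t x) =
  dir_tr (formal_sys N) t (formal_sys_map t x).
Proof. by apply: local_homology_map_square => y; exact: val_inj. Qed.

End Map.

End Nat.

Definition formal_local_homology (i : int) (M : lmodType R) : lmodType R :=
  match i with
  | Posz n => dirlim (formal_sys n M)
  | Negz _ => 'rV[R]_0
  end.

Definition formal_local_homology_map (i : int) (M N : lmodType R)
    (f : {linear M -> N}) :
    {linear formal_local_homology i M -> formal_local_homology i N} :=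
  match i return
    {linear formal_local_homology i M -> formal_local_homology i N} with
  | Posz n => dirlim_map (formal_sys_map_tr (i := n) f)
  | Negz _ => idfun
  end.

End FormalLocalHomology.

Definition exact_at (R : comNzRingType) (U V W : lmodType R)
    (f : {linear U -> V}) (g : {linear V -> W}) : Prop :=
  forall y, g y = 0 <-> exists x, f x = y.

Definition short_exact (R : comNzRingType) (U V W : lmodType R)
    (f : {linear U -> V}) (g : {linear V -> W}) : Prop :=
  [/\ injective f, exact_at f g & forall z, exists y, g y = z].

(* Main.v *)
(* The functor N |-> 0 :_N I^t is only left exact, but the images B_t of       *)
(* 0 :_M I^t in M'' form short exact sequences                                *)
(*   0 -> 0 :_M' I^t -> 0 :_M I^t -> B_t -> 0,                                *)
(* and by an Artin-Rees lemma for artinian modules every 0 :_M'' I^t lies in  *)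
(* some B_s, so both filtrations of M'' yield the same direct limit of local  *)
(* homology. Local homology has long exact sequences on artinian modules:     *)
(* Tor_i(R/m^s, N) is artinian (it is a quotient of the homology of a finite  *)
(* free resolution tensored with N), hence the Mittag-Leffler condition makes *)
(* the inverse limits of the long exact Tor sequences exact. Direct limits    *)
(* are exact.                                                                 *)

Require Import Defs.
From HB Require Import structures.
From mathcomp Require Import all_boot all_algebra.
From mathcomp Require Import boolp freeg.
(* mathcomp's vector.v shadows [span]. *)
Import Defs.

Set Implicit Arguments.
Unset Strict Implicit.
Unset Printing Implicit Defensive.

Import GRing.Theory.
Local Open Scope ring_scope.

(** * Artinian modules and the dual Artin-Rees lemma *)

(** The functor 0 :_(-) I^t is only left exact, so M'' is filtered by the images B_t of 0 :_M I^t
    ([ann_im]). This gives short exact sequences 0 -> 0 :_M' I^t -> 0 :_M I^t -> B_t -> 0 of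
    artinian modules ([ann_short_exact]). Tensoring with a free resolution of R/m^s is exact
    ([tens_free_exact]), so the snake lemma yields long exact Tor sequences, natural in s and t
    ([Tor_connecting_nat]).

    The limit over s preserves exactness by Mittag-Leffler ([invlim_exact]): as R is noetherian,
    R/m^s has a resolution by finite free modules, so Tor_i(R/m^s, N) is a quotient of a subquotient
    of some N^k and is artinian when N is ([Tor_artinian]). The limit over t is always exact
    ([dirlim_exact]).

    It remains to replace B_t by 0 :_M'' I^t, which contains it. Conversely [dual_artin_rees] puts 0
    :_M'' I^t inside some B_s, so the two systems interleave and have the same direct limit
    ([im_sys_incl_bij]). The sequence is transported along this isomorphism; in degree 0 it ends
    with a surjection ([formal_surj0]). *)

Lemma dependent_choice (T : nat -> Type) (P : forall n, T n -> Prop)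
    (Q : forall n, T n -> T n.+1 -> Prop) :
    (exists x, P 0 x) ->
    (forall n x, P n x -> exists2 y, P n.+1 y & Q n x y) ->
  exists2 u : forall n, T n,
    (forall n, P n (u n)) & forall n, Q n (u n) (u n.+1).
Proof.
case=> x0 Px0 step.
have next n (x : {x | P n x}) : {y : {y | P n.+1 y} | Q n (sval x) (sval y)}.
  case: x => x Px; have [y Py Qxy] := cid2 (step n x Px).
  by exists (exist _ y Py).
pose u := fix u n : {x | P n x} :=
  if n is k.+1 then sval (next k (u k)) else exist _ x0 Px0.
exists (fun n => sval (u n)) => n; first exact: svalP.
exact: svalP (next n (u n)).
Qed.

(** * Linear maps given by their graphs, and submodules *)

Section Linear.
Variable R : comNzRingType.

(** Two values over the same [u] differ by a value over 0, so the relation is the graph of a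
    function. Connecting maps are built this way, which reduces independence of choices to a check
    over 0. *)
Lemma linear_of_rel (U V : lmodType R) (P : U -> V -> Prop) :
    (forall u, exists v, P u v) -> (forall v, P 0 v -> v = 0) ->
    (forall a u u' v v', P u v -> P u' v' -> P (a *: u + u') (a *: v + v')) ->
  exists f : {linear U -> V}, forall u v, f u = v <-> P u v.
Proof.
move=> Ptot P0 Plin; pose f u := sval (cid (Ptot u)).
have Pf u : P u (f u) by rewrite /f; case: cid.
have Pfun u v : P u v -> f u = v.
  move=> Puv; apply/eqP; rewrite -subr_eq0 addrC -scaleN1r; apply/eqP/P0.
  have -> : 0 = -1 *: u + u by rewrite scaleN1r addNr.
  exact: Plin.
have f_linear : linear f by move=> a u v; apply: Pfun; exact: Plin.
exists (mk_linear f_linear) => u v; split=> [<-|]; [exact: Pf | exact: Pfun].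
Qed.

Lemma submodN (U : lmodType R) (S : submodClosed U) x : x \in S -> - x \in S.
Proof. by move=> Sx; rewrite -scaleN1r rpredZ. Qed.

Lemma submodB (U : lmodType R) (S : submodClosed U) x y :
  x \in S -> y \in S -> x - y \in S.
Proof. by move=> Sx Sy; rewrite rpredD ?submodN. Qed.

Definition im_submod (U V : lmodType R) (f : {linear U -> V})
  (S : submodClosed U) : submodClosed V := iml (f \o incl S).

Lemma im_submodP (U V : lmodType R) (f : {linear U -> V}) (S : submodClosed U)
    y : y \in im_submod f S <-> exists2 x, x \in S & f x = y.
Proof.
split=> [/mk_submodP[x <-]|[x Sx <-]]; first by exists (val x); first exact: valP.
by apply/mk_submodP; exists (exist _ x Sx).
Qed.

Lemma cap_prop (U : lmodType R) (S T : submodClosed U) :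
  submod_prop (fun x => x \in S /\ x \in T).
Proof.
split=> [|a u v [Su Tu] [Sv Tv]]; first by rewrite !rpred0.
by split; rewrite rpredD ?rpredZ.
Qed.

Definition cap_submod (U : lmodType R) (S T : submodClosed U) : submodClosed U :=
  mk_submod (cap_prop S T).

Section Artinian.

Lemma descending (U : lmodType R) (S : nat -> submodClosed U) n k :
    (forall n, {subset S n.+1 <= S n}) -> (n <= k)%N -> {subset S k <= S n}.
Proof.
move=> Sdec /subnK<-; elim: (k - n)%N => [|d IH] x //= Sx.
by apply: IH; apply: Sdec.
Qed.

(** Once the images in [V] and the traces on the kernel are both constant, an element of the larger
    term differs from one of the smaller term by a kernel element of the larger term, which then
    lies in the smaller one too. *)
Lemma artinian_ext (U V : lmodType R) (f : {linear U -> V}) :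
  artinian V -> artinian (submod (kerl f)) -> artinian U.
Proof.
move=> artV artK S Sdec.
have [|n hn] := artV (fun n => im_submod f (S n)).
  move=> n y /im_submodP[x Sx <-]; apply/im_submodP.
  by exists x => //; exact: Sdec.
have [|p hp] := artK (fun n => preim_submod (incl (kerl f)) (S n)).
  by move=> k x /mk_submodP Sx; apply/mk_submodP; exact: Sdec.
exists (maxn n p) => k; rewrite geq_max => /andP[nk pk] x.
apply/idP/idP=> [|Sx]; first by apply: descending; rewrite // geq_max nk pk.
have : f x \in im_submod f (S k).
  rewrite hn // -(hn (maxn n p)) ?leq_maxl //; apply/im_submodP.
  by exists x.
move=> /im_submodP[y Sy fyx].
have Kxy : x - y \in kerl f by apply/mk_submodP; rewrite linearB fyx subrr.
rewrite -(subrK y x) rpredD //.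
suff /mk_submodP : (exist _ (x - y) Kxy : submod (kerl f)) \in
  preim_submod (incl (kerl f)) (S k) by [].
rewrite hp // -(hp (maxn n p)) ?leq_maxr //; apply/mk_submodP => /=.
rewrite submodB //; apply: descending Sy => //.
by rewrite geq_max nk pk.
Qed.

Lemma artinian_zero (U : lmodType R) : (forall x : U, x = 0) -> artinian U.
Proof. by move=> U0 S _; exists 0%N => k _ x; rewrite [x]U0 !rpred0. Qed.

Lemma artinian_inj (U V : lmodType R) (f : {linear U -> V}) :
  injective f -> artinian V -> artinian U.
Proof.
move=> f_inj /artinian_ext; apply; apply: artinian_zero => -[x Kx].
have fx0 : f x = 0 by apply/(mk_submodP (kerl_prop f)); exact: Kx.
by apply/val_inj/f_inj; exact: etrans fx0 (esym (linear0 f)).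
Qed.

Lemma artinian_sub (U : lmodType R) (S : submodClosed U) :
  artinian U -> artinian (submod S).
Proof. by apply: (@artinian_inj _ _ (incl S)); exact: val_inj. Qed.

Lemma artinian_surj (U V : lmodType R) (f : {linear U -> V}) :
  (forall y, exists x, f x = y) -> artinian U -> artinian V.
Proof.
move=> f_surj artU S Sdec.
have [|n hn] := artU (fun n => preim_submod f (S n)).
  by move=> k x /mk_submodP Sx; apply/mk_submodP; exact: Sdec.
exists n => k nk y; have [x <-] := f_surj y; have := hn k nk x.
by move=> e; apply/idP/idP => /(mk_submodP (preim_prop f _));
  [rewrite e | rewrite -e] => /mk_submodP.
Qed.

(** Induction on [n]: on the kernel of the last map the remaining ones are still jointly injective,
    and [artinian_ext] adds the last one back. *)
Lemma artinian_joint_inj n (U V : lmodType R) (c : nat -> {linear U -> V}) :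
    artinian V -> (forall x, (forall i, (i < n)%N -> c i x = 0) -> x = 0) ->
  artinian U.
Proof.
move=> artV; elim: n U c => [|n IH] U c c_inj.
  by apply: artinian_zero => x; apply: c_inj.
apply: (artinian_ext (f := c n)) => //.
apply: (IH _ (fun i => c i \o incl (kerl (c n)))) => -[x Kx] /= cx.
apply/val_inj/c_inj => /= i; rewrite ltnS leq_eqVlt => /orP[/eqP->|/cx //].
by apply/(mk_submodP (kerl_prop (c n))); exact: Kx.
Qed.

End Artinian.

(** * Submodules of finitely generated modules over a noetherian ring *)

Section FinitelyGenerated.

Definition span_seq (U : lmodType R) (s : seq U) : submodClosed U :=
  span (fun x => x \in s).

Lemma span_seq_mem (U : lmodType R) (s : seq U) x : x \in s -> x \in span_seq s.
Proof. exact: span_gen. Qed.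

Lemma span_seq_min (U : lmodType R) (s : seq U) (S : submodClosed U) :
  {subset s <= S} -> {subset span_seq s <= S}.
Proof. exact: span_min. Qed.

Lemma span_consP (U : lmodType R) (x : U) (s : seq U) y :
  y \in span_seq (x :: s) -> exists a, exists2 z, z \in span_seq s & y = a *: x + z.
Proof.
have Pprop : submod_prop (fun y =>
    exists a, exists2 z, z \in span_seq s & y = a *: x + z).
  split=> [|b _ _ [a [z Sz ->]] [a' [z' Sz' ->]]].
    by exists 0, 0; rewrite ?rpred0 // scale0r addr0.
  exists (b * a + a'), (b *: z + z'); first by rewrite rpredD ?rpredZ.
  by rewrite scalerDr scalerA scalerDl addrACA.
move=> Sy; apply/(mk_submodP Pprop); move: y Sy; apply: span_seq_min => y.
rewrite inE => /orP[/eqP->|sy]; apply/mk_submodP.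
  by exists 1, 0; rewrite ?rpred0 // scale1r addr0.
by exists 0, y; rewrite ?span_seq_mem // scale0r add0r.
Qed.

(** Induction on the generators: the coefficients of the head generator occurring in [S] form a
    finitely generated ideal. Lifts of its generators to [S], together with generators of the part
    of [S] in the span of the tail, generate [S]. *)
Lemma noetherian_span (U : lmodType R) (s : seq U) (S : submodClosed U) :
    noetherian_ring R -> {subset S <= span_seq s} ->
  exists s' : seq U, S =i span_seq s'.
Proof.
move=> noethR; elim: s S => [|x s IH] S Ss.
  exists [::] => y; apply/idP/idP; first exact: Ss.
  exact: span_seq_min.
have Jprop : submod_prop (fun a : R^o =>
    exists2 z, z \in span_seq s & a *: x + z \in S).
  split=> [|b a a' [z sz Sz] [z' sz' Sz']].
    by exists 0; rewrite ?rpred0 // scale0r addr0 rpred0.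
  exists (b *: z + z'); first by rewrite rpredD ?rpredZ.
  suff -> : (b *: a + a') *: x + (b *: z + z') =
    b *: (a *: x + z) + (a' *: x + z') by rewrite rpredD ?rpredZ.
  by rewrite scalerDl -[b *: a]/(b * a) -scalerA addrACA scalerDr.
have [s1 hs1] : exists s1, cap_submod S (span_seq s) =i span_seq s1.
  by apply: IH => y /mk_submodP[].
have [l hl] := noethR (mk_submod Jprop).
(* [s2] holds, for each generator of the coefficient ideal, an element of [S] with that leading
   coefficient. *)
have [s2 s2S hs2] : exists2 s2 : seq U, {subset s2 <= S} & forall a, a \in l ->
    exists2 y, y \in s2 & a *: x - y \in span_seq s.
  have : {subset l <= mk_submod Jprop} by move=> a la; rewrite hl span_gen.
  elim: (l) => [|a l' IHl] hJ; first by exists [::].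
  have [b lb|s2 s2S hs2] := IHl; first by apply: hJ; rewrite inE lb orbT.
  have /mk_submodP[z sz Sz] := hJ a (mem_head a l').
  exists (a *: x + z :: s2) => [y|b].
    by rewrite inE => /orP[/eqP->|/s2S].
  rewrite inE => /orP[/eqP->|/hs2[y s2y hy]].
    by exists (a *: x + z); rewrite ?mem_head // opprD addNKr submodN.
  by exists y => //; rewrite inE s2y orbT.
have s1S : {subset s1 <= S}.
  move=> y /span_seq_mem; rewrite -hs1.
  by move=> /(mk_submodP (cap_prop S (span_seq s)))[].
exists (s2 ++ s1) => y; apply/idP/idP=> [Sy|]; last first.
  by apply: span_seq_min => z; rewrite mem_cat => /orP[/s2S|/s1S].
have sub1 : {subset span_seq s1 <= span_seq (s2 ++ s1)}.
  by apply: span_seq_min => z s1z; rewrite span_seq_mem // mem_cat s1z orbT.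
have sub2 : {subset span_seq s2 <= span_seq (s2 ++ s1)}.
  by apply: span_seq_min => z s1z; rewrite span_seq_mem // mem_cat s1z.
have [a [z sz yE]] := span_consP (Ss y Sy).
(* Coefficients attained on the span of [s2]: an ideal containing [l], hence the whole coefficient
   ideal. *)
have Kprop : submod_prop (fun a : R^o =>
    exists2 y, y \in span_seq s2 & a *: x - y \in span_seq s).
  split=> [|b c c' [u su cu] [u' su' cu']].
    by exists 0; rewrite ?rpred0 // scale0r subr0 rpred0.
  exists (b *: u + u'); first by rewrite rpredD ?rpredZ.
  suff -> : (b *: c + c') *: x - (b *: u + u') =
    b *: (c *: x - u) + (c' *: x - u') by rewrite rpredD ?rpredZ.
  by rewrite scalerDl -[b *: c]/(b * c) -scalerA opprD addrACA scalerBr.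
have Ja : (a : R^o) \in mk_submod Jprop.
  by apply/mk_submodP; exists z; rewrite // -yE.
have : (a : R^o) \in mk_submod Kprop.
  rewrite hl in Ja; move: (a : R^o) Ja; apply: span_min => b lb.
  apply/mk_submodP; have [w s2w hw] := hs2 b lb; exists w; first exact: span_seq_mem.
  exact: hw.
move=> /mk_submodP[w s2w hw].
have Sw : w \in S by move: w s2w {hw}; exact: span_seq_min.
rewrite -(subrK w y); apply: rpredD; last exact: sub2.
apply: sub1; rewrite -hs1; apply/mk_submodP.
by split; [rewrite submodB | rewrite yE addrAC rpredD].
Qed.

End FinitelyGenerated.

(** * The dual Artin-Rees lemma *)

Section DualArtinRees.

(** The [a] such that I^n kills [a *: y] form an ideal, so it is enough to test the generators of
    [I]. *)
Lemma ideal_pow_ann_gen (I : submodClosed R^o) (l : seq R^o)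
    (M : lmodType R) n (y : M) : I =i span_seq l ->
    (forall x, x \in l -> (x : R) *: y \in ann M (ideal_pow I n)) ->
  y \in ann M (ideal_pow I n.+1).
Proof.
move=> Il hl; apply/mk_submodP.
have Jprop : submod_prop (fun a : R^o => (a : R) *: y \in ann M (ideal_pow I n)).
  split=> [|b a a' ha ha']; first by rewrite (scale0r y) rpred0.
  rewrite (scalerDl y) -[b *: a]/(b * a) -scalerA.
  by apply: rpredD ha'; exact: rpredZ.
have IJ : {subset I <= mk_submod Jprop}.
  by move=> a; rewrite Il; apply: span_min => x lx; apply/mk_submodP; exact: hl.
have Aprop : submod_prop (fun a : R^o => (a : R) *: y = 0).
  split=> [|b a a' ha ha']; first by rewrite (scale0r y).
  by rewrite (scalerDl y) -[b *: a]/(b * a) -scalerA ha ha' scaler0 addr0.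
suff JA : {subset ideal_mul I (ideal_pow I n) <= mk_submod Aprop}.
  by move=> a Ia; apply/(mk_submodP Aprop)/JA.
apply: span_min => _ [a [b [Ia Ib ->]]]; apply/mk_submodP.
have /mk_submodP/mk_submodP := IJ a Ia => /(_ b Ib).
by rewrite scalerA mulrC.
Qed.

(** Pigeonhole: a monomial of degree n+1 in the generators contains some [x] at least [e x] times,
    hence kills [y]. *)
Lemma ideal_pow_ann (I : submodClosed R^o) (l : seq R^o) (M : lmodType R)
    (e : R^o -> nat) n (y : M) : I =i span_seq l ->
    (\sum_(x <- l) e x <= n)%N ->
    (forall x, x \in l -> (x : R) ^+ e x *: y = 0) ->
  y \in ann M (ideal_pow I n.+1).
Proof.
move=> Il; elim: n e y => [|n IH] e y le hy; apply: (ideal_pow_ann_gen Il) => x lx.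
all: have [e0|e_gt0] := posnP (e x);
  first by have := hy x lx; rewrite e0 expr0 scale1r => ->; rewrite scaler0 rpred0.
  by move: le; rewrite leqn0 (big_rem x) //= addn_eq0 -leqn0 leqNgt e_gt0.
(* Passing from [y] to [x *: y] lowers the exponent needed for [x] by one; the sum drops by at least
   one, even if [x] is repeated in [l]. *)
apply: (IH (fun z => if z == x then (e z).-1 else e z)) => [|z lz].
  rewrite -ltnS; apply: leq_trans le.
  rewrite (big_rem x) //= [X in (_ < X)%N](big_rem x) //= eqxx.
  rewrite -addSn prednK // leq_add2l; apply: leq_sum => z _.
  by case: eqP => // _; exact: leq_pred.
case: (eqVneq z x) => [->|_]; first by rewrite scalerA -exprSr prednK ?hy.
by rewrite scalerA mulrC -scalerA hy // scaler0.
Qed.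

(** The colon submodule K :_M J, taken as the preimage of 0 :_(M/K) J. *)
Definition colon_submod (M : lmodType R) (K : submodClosed M)
    (J : submodClosed R^o) : submodClosed M :=
  preim_submod (quot_pi K) (ann (quotm K) J).

(* Fitting decomposition of x on the artinian module L: x^n L = x^(2n) L gives *)
(* L = x^n L + (0 :_L x^n), and x^n L lies in K as soon as n >= t.             *)
Lemma ann_power_cover (M : lmodType R) (K L : submodClosed M) (x : R) t :
    artinian M -> (forall y, y \in L -> x ^+ t *: y \in K) ->
  exists n, forall y, y \in L ->
    exists2 z, z \in L /\ x ^+ n *: z = 0 & y - z \in K.
Proof.
move=> artM xLK.
have mul_prop n : linear (fun y : M => x ^+ n *: y).
  by move=> a u v; rewrite scalerDr !scalerA mulrC.
have [|n hn] := artM (fun n => im_submod (mk_linear (mul_prop n)) L).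
  move=> n _ /im_submodP[y Ly <-]; apply/im_submodP.
  by exists (x *: y); rewrite ?rpredZ //= scalerA -exprSr.
have le_n := leq_maxl n t; pose p := maxn n t.
have hp k : (p <= k)%N -> im_submod (mk_linear (mul_prop k)) L =i
    im_submod (mk_linear (mul_prop p)) L.
  by move=> pk y; rewrite hn ?(leq_trans le_n) // -(hn p).
exists p => y Ly; have : x ^+ p *: y \in im_submod (mk_linear (mul_prop (p + p)%N)) L.
  by rewrite hp ?leq_addr //; apply/im_submodP; exists y.
move=> /im_submodP[z Lz /= xz]; exists (y - x ^+ p *: z).
  split; first by rewrite submodB ?rpredZ.
  by rewrite scalerBr scalerA -exprD xz subrr.
rewrite opprB addrC subrK /p -(subnK (leq_maxr n t)) exprD -scalerA.
by rewrite rpredZ ?xLK.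
Qed.

(** Modulo [K], an element of K :_M I^t is replaced, one generator of [I] at a time, by one killed
    by a power of that generator ([ann_power_cover]). The exponents depend only on the modules, and
    [ideal_pow_ann] turns them into one power of [I]. *)
Theorem dual_artin_rees (M : lmodType R) (K : submodClosed M)
    (I : submodClosed R^o) t :
    noetherian_ring R -> artinian M ->
  exists s, forall y, y \in colon_submod K (ideal_pow I t) ->
    exists2 z, z \in ann M (ideal_pow I s) & y - z \in K.
Proof.
move=> noethR artM; have [l Il] := noethR I; pose P := colon_submod K (ideal_pow I t).
have pow_in x k : (x : R^o) \in I -> (x ^+ k : R^o) \in ideal_pow I k.
  move=> Ix; elim: k => [|k IHk]; first by apply/mk_submodP.
  by apply: span_gen; exists x, (x ^+ k); rewrite exprS.
have Pmul x y : x \in I -> y \in P -> x ^+ t *: y \in K.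
  move=> Ix /mk_submodP/mk_submodP/(_ _ (pow_in _ t Ix)).
  by rewrite -linearZ -(linear0 (quot_pi K)) => /quot_piP; rewrite subr0.
have [e he] : exists e : R^o -> nat, forall y, y \in P -> exists2 z,
    (z \in P /\ forall x : R^o, x \in l -> (x : R) ^+ e x *: z = 0) & y - z \in K.
  have : {subset l <= I} by move=> x lx; rewrite Il; exact: span_gen.
  elim: (l) => [|x l' IHl] lI.
    by exists (fun=> 0%N) => y Py; exists y; rewrite // subrr rpred0.
  have [z lz|e he] := IHl; first by apply: lI; rewrite inE lz orbT.
  (* Elements already killed by powers of the earlier generators form a submodule; splitting inside
     it keeps that property. *)
  have Lprop : submod_prop (fun z => z \in P /\
      forall x : R^o, x \in l' -> (x : R) ^+ e x *: z = 0).
    split=> [|a u v [Pu hu] [Pv hv]].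
      by rewrite rpred0; split=> // z _; rewrite scaler0.
    split=> [|z lz]; first by rewrite rpredD ?rpredZ.
    by rewrite scalerDr scalerA mulrC -scalerA hu // hv // scaler0 addr0.
  have [|n hn] := @ann_power_cover M K (mk_submod Lprop) x t artM.
    by move=> y /mk_submodP[Py _]; apply: Pmul => //; apply: lI; rewrite mem_head.
  (* Adding [n] to every exponent serves old and new generators alike, even if [x] already occurs in
     [l']. *)
  exists (fun z => (e z + n)%N) => y /he[z Lz Kyz].
  have [|w [/mk_submodP[Pw hw] xw] Kzw] := hn z; first by apply/mk_submodP.
  exists w; last by rewrite -(subrK z y) -addrA rpredD.
  split=> // v; rewrite inE => /orP[/eqP->|lv].
    by rewrite exprD -scalerA xw scaler0.
  by rewrite addnC exprD -scalerA hw // scaler0.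
exists (\sum_(x <- l) e x).+1 => y /he[z [_ hz] Kyz]; exists z => //.
exact: ideal_pow_ann Il (leqnn _) hz.
Qed.

End DualArtinRees.

End Linear.

(** * Tensor products with free modules *)

Section TensorCoordinates.
Variable R : comNzRingType.

Lemma quot_lift (U V : lmodType R) (S : submodClosed U) (f : {linear U -> V}) :
    (forall x, x \in S -> f x = 0) ->
  exists g : {linear quotm S -> V}, forall x, g (quot_pi S x) = f x.
Proof.
move=> fS; pose g q := f (@quot_rep R U S q).
have gE x : g (quot_pi S x) = f x.
  apply/eqP; rewrite -subr_eq0 -linearB; apply/eqP/fS/quot_piP.
  exact: quot_repK.
have g_linear : linear g.
  move=> a q r; rewrite -[q]quot_repK -[r]quot_repK.
  by rewrite -(linearP (quot_pi S)) !gE linearP.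
by exists (mk_linear g_linear).
Qed.

Lemma tens_lift (A N V : lmodType R) (b : A -> N -> V) :
    (forall x, linear (b^~ x)) -> (forall a, linear (b a)) ->
  exists g : {linear tens A N -> V}, forall a x, g (tensor a x) = b a x.
Proof.
move=> blin blin'; pose f := free_lift (fun u : A * N => b u.1 u.2).
have fE a x : f (@freeb R (A * N)%type (a, x)) = b a x by rewrite free_liftE.
have fS u : u \in span (@tens_rel R A N) -> f u = 0.
  suff /span_min h : forall y, @tens_rel R A N y -> y \in kerl f.
    by move=> /h /mk_submodP.
  move=> _ [a a' x|a x y|r a x|r a x]; apply/mk_submodP.
  - rewrite 2!linearB !fE; apply/eqP; rewrite subr_eq0 subr_eq addrC; apply/eqP.
    exact: (linearD (mk_linear (blin x))).
  - rewrite 2!linearB !fE; apply/eqP; rewrite subr_eq0 subr_eq addrC; apply/eqP.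
    exact: (linearD (mk_linear (blin' a))).
  - rewrite linearB (linearZ_LR f) !fE; apply/eqP; rewrite subr_eq0; apply/eqP.
    exact: (linearZ_LR (mk_linear (blin x))).
  - rewrite linearB (linearZ_LR f) !fE; apply/eqP; rewrite subr_eq0; apply/eqP.
    exact: (linearZ_LR (mk_linear (blin' a))).
have [g gE] := quot_lift fS.
by exists g => a x; rewrite [LHS]gE fE.
Qed.

(** The projection to the quotient by [S] vanishes on pure tensors, hence everywhere. *)
Lemma tens_ind (A N : lmodType R) (S : submodClosed (tens A N)) :
  (forall a x, tensor a x \in S) -> forall u, u \in S.
Proof.
move=> hS u; rewrite -[u]subr0; apply/quot_piP; rewrite linear0.
apply: (@tens_ext R A N _ (quot_pi S) \0) => a x.
by rewrite -[RHS](linear0 (quot_pi S)); apply/quot_piP; rewrite subr0.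
Qed.

Lemma freem_ind (X : choiceType) (S : submodClosed (freem R X)) :
  (forall x, freeb R x \in S) -> forall D, D \in S.
Proof.
by move=> hS D; rewrite [D]freemE rpred_sum // => x _; rewrite rpredZ.
Qed.

Section Free.
Variables (X : choiceType) (N : lmodType R).

(** These coordinates identify the tensor product with a direct sum of copies of [N]; each comes
    from the bilinear map sending [D] and [n] to [coeff x D *: n]. *)
Lemma tens_coord_ex (x : X) : exists c : {linear tens (freem R X) N -> N},
  forall y n, c (tensor (freeb R y) n) = if y == x then n else 0.
Proof.
have [|a|c cE] := @tens_lift (freem R X) N N (fun D n => coeff x D *: n).
- by move=> n a D E; rewrite coeffD coeffZ scalerDl scalerA.
- by move=> b n n'; rewrite scalerDr !scalerA mulrC.
exists c => y n; rewrite cE /freeb coeffU mul1r.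
by case: eqP => _; rewrite ?scale1r ?scale0r.
Qed.

Definition tens_coord (x : X) := sval (cid (tens_coord_ex x)).

Lemma tens_coordE x y n :
  tens_coord x (tensor (freeb R y) n) = if y == x then n else 0.
Proof. by rewrite /tens_coord; case: cid => c /=. Qed.

Lemma tens_free_ind (S : submodClosed (tens (freem R X) N)) :
  (forall x n, tensor (freeb R x) n \in S) -> forall u, u \in S.
Proof.
move=> hS; apply: tens_ind => D n.
have tens_linear : linear (fun D : freem R X => tensor D n).
  by move=> a D1 D2; rewrite tensorDl tensorZl.
suff /mk_submodP : D \in preim_submod (mk_linear tens_linear) S by [].
by apply: freem_ind => x; apply/mk_submodP; exact: hS.
Qed.

Lemma tens_free_ext (V : lmodType R) (g h : {linear tens (freem R X) N -> V}) :
  (forall x n, g (tensor (freeb R x) n) = h (tensor (freeb R x) n)) -> g =1 h.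
Proof.
move=> gh u; apply/eqP; rewrite -subr_eq0; apply/eqP.
suff /mk_submodP : u \in kerl (g \- h) by [].
by apply: tens_free_ind => x n; apply/mk_submodP; rewrite /= gh subrr.
Qed.

(** Allowing every larger duplicate-free list [s'] lets two finite supports be merged when elements
    are added. *)
Lemma tens_coord_sum (u : tens (freem R X) N) : exists s : seq X,
  forall s', uniq s' -> {subset s <= s'} ->
    u = \sum_(x <- s') tensor (freeb R x) (tens_coord x u).
Proof.
have Pprop : submod_prop (fun u : tens (freem R X) N => exists s : seq X,
    forall s', uniq s' -> {subset s <= s'} ->
      u = \sum_(x <- s') tensor (freeb R x) (tens_coord x u)).
  split=> [|a v w [s hs] [t ht]].
    exists [::] => s _ _; rewrite big1 // => x _.
    by rewrite linear0 -[0 in LHS](scale0r (0 : N)) tensorZr scale0r.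
  exists (s ++ t) => s' us' sub.
  rewrite [v in LHS](hs s') // => [|x sx]; last by rewrite sub // mem_cat sx.
  rewrite [w in LHS](ht s') // => [|x tx]; last by rewrite sub // mem_cat tx orbT.
  rewrite scaler_sumr -big_split /=; apply: eq_bigr => x _.
  by rewrite -tensorZr -tensorDr linearP.
apply/(mk_submodP Pprop); apply: tens_free_ind => x n; apply/mk_submodP.
exists [:: x] => s us /(_ x (mem_head _ _)) sx.
rewrite (bigD1_seq x) //= tens_coordE eqxx big1 ?addr0 // => y yx.
rewrite tens_coordE eq_sym (negPf yx).
by rewrite -[0 in LHS](scale0r (0 : N)) tensorZr scale0r.
Qed.

Lemma tens_coord_eq0 (u : tens (freem R X) N) :
  (forall x, tens_coord x u = 0) -> u = 0.
Proof.
move=> cu; have [s /(_ (undup s) (undup_uniq s))->] := tens_coord_sum u.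
  rewrite big1 // => x _.
  by rewrite cu -[0 in LHS](scale0r (0 : N)) tensorZr scale0r.
by move=> x; rewrite mem_undup.
Qed.

End Free.

Arguments tens_coord {X N} x.

(** [e] is only pointwise the identity because it will be the map that [idfun] induces on a
    resolution. *)
Lemma tens_coord_map (X : choiceType) (N P : lmodType R)
    (e : {linear freem R X -> freem R X}) (g : {linear N -> P}) x u :
  e =1 id -> tens_coord x (tens_map e g u) = g (tens_coord x u).
Proof.
move=> eE.
apply: (@tens_free_ext X N _ (tens_coord x \o tens_map e g) (g \o tens_coord x)).
move=> y n; suff : tens_coord x (tens_map e g (tensor (freeb R y) n)) =
    g (tens_coord x (tensor (freeb R y) n)) by [].
by rewrite tens_mapE eE !tens_coordE; case: eqP; rewrite ?linear0.
Qed.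

Lemma tens_map_free_id (X : choiceType) (N : lmodType R)
    (e : {linear freem R X -> freem R X}) (g : {linear N -> N}) :
  e =1 id -> g =1 id -> tens_map e g =1 id.
Proof.
move=> eE gE; apply: (@tens_free_ext X N _ (tens_map e g) idfun) => x n.
by rewrite tens_mapE eE gE.
Qed.

Lemma free_map_id (X : choiceType) (f : X -> X) : f =1 id -> free_map R f =1 id.
Proof.
move=> fE; apply: (@free_ext R X _ (free_map R f) idfun) => x.
by rewrite free_mapE fE.
Qed.

(** Free modules are flat: preimages are chosen in each coordinate and summed over a finite
    support. *)
Lemma tens_free_exact (X : choiceType) (N' N N'' : lmodType R)
    (e : {linear freem R X -> freem R X})
    (j : {linear N' -> N}) (p : {linear N -> N''}) :
  e =1 id -> short_exact j p -> short_exact (tens_map e j) (tens_map e p).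
Proof.
move=> eE [j_inj jp p_surj]; split.
- move=> u v /eqP; rewrite -subr_eq0 -linearB => /eqP uv.
  apply/eqP; rewrite -subr_eq0; apply/eqP/tens_coord_eq0 => x.
  by apply: j_inj; rewrite -(tens_coord_map j x _ eE) uv !linear0.
- move=> u; split=> [pu|[v <-]]; last first.
    apply: tens_coord_eq0 => x; rewrite !(tens_coord_map _ _ _ eE).
    by apply/jp; exists (tens_coord x v).
  have /choice[n jn] x : exists n, j n = tens_coord x u.
    by apply/jp; rewrite -(tens_coord_map p x _ eE) pu linear0.
  have [s /(_ (undup s) (undup_uniq s))hs] := tens_coord_sum u.
  exists (\sum_(x <- undup s) tensor (freeb R x) (n x)).
  rewrite linear_sum [RHS]hs; last by move=> x; rewrite mem_undup.
  by apply: eq_bigr => x _; rewrite tens_mapE eE jn.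
move=> u; have /choice[n pn] x : exists n, p n = tens_coord x u by exact: p_surj.
have [s /(_ (undup s) (undup_uniq s))hs] := tens_coord_sum u.
exists (\sum_(x <- undup s) tensor (freeb R x) (n x)).
rewrite linear_sum [RHS]hs; last by move=> x; rewrite mem_undup.
by apply: eq_bigr => x _; rewrite tens_mapE eE pn.
Qed.

End TensorCoordinates.

Arguments tens_coord {R X N} x.

(** * Long exact sequences of homology and Tor *)

Section Snake.
Variable R : comNzRingType.

Definition cycle (C : complex R) n : lmodType R := submod (cycles C n).

Definition mk_cycle (C : complex R) n x (Zx : x \in cycles C n) : cycle C n :=
  exist _ x Zx.

Definition cycle_val (C : complex R) n : {linear cycle C n -> C n} :=
  incl (cycles C n).

Lemma cycle_val_inj (C : complex R) n : injective (cycle_val C n).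
Proof. exact: val_inj. Qed.

Lemma cycle_valP (C : complex R) n (z : cycle C n) : cycle_val C n z \in cycles C n.
Proof. exact: valP. Qed.

Definition hclass (C : complex R) n : {linear cycle C n -> homology C n} :=
  quot_pi _.

Definition cycle_map (C D : complex R) (f : cxmap C D) n :
  {linear cycle C n -> cycle D n} := cycles_map f n.

Lemma cycle_mapE (C D : complex R) (f : cxmap C D) n z :
  cycle_val D n (cycle_map f n z) = f n (cycle_val C n z).
Proof. by []. Qed.

Lemma hclass_surj (C : complex R) n (h : homology C n) : exists z, hclass C n z = h.
Proof. by exists (quot_rep h); exact: quot_repK. Qed.

Lemma hclass_eq0 (C : complex R) n (z : cycle C n) :
  hclass C n z = 0 <-> exists y, cx_d C n y = cycle_val C n z.
Proof.
rewrite -(linear0 (hclass C n)); split=> [/quot_piP|[y dy]].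
  by rewrite subr0 => /mk_submodP/mk_submodP.
by apply/quot_piP; rewrite subr0; apply/mk_submodP/mk_submodP; exists y.
Qed.

Lemma homology_mapE (C D : complex R) (f : cxmap C D) n z :
  homology_map f n (hclass C n z) = hclass D n (cycle_map f n z).
Proof. exact: quot_mapE. Qed.

Lemma boundary_cycle (C : complex R) n (y : C n.+1) : cx_d C n y \in cycles C n.
Proof. by case: n y => [|n] y; apply/mk_submodP => //; exact: cx_dd. Qed.

Lemma cycles_inj (C D : complex R) (f : cxmap C D) n x :
  (forall k, injective (f k)) -> f n x \in cycles D n -> x \in cycles C n.
Proof.
move=> f_inj; case: n x => [|n] x /mk_submodP fx; apply/mk_submodP => //.
by apply: (f_inj n); rewrite -cxm_d fx linear0.
Qed.

Section ShortExact.
Variables (C' C C'' : complex R) (j : cxmap C' C) (p : cxmap C C'').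
Hypothesis jp : forall n, short_exact (j n) (p n).

Let j_inj n : injective (j n). Proof. by case: (jp n). Qed.
Let jpE n : exact_at (j n) (p n). Proof. by case: (jp n). Qed.
Let p_surj n z : exists y, p n y = z. Proof. by case: (jp n). Qed.
Let pj n x : p n (j n x) = 0. Proof. by apply/jpE; exists x. Qed.

Lemma homology_exact n : exact_at (homology_map j n) (homology_map p n).
Proof.
move=> h; split=> [|[h' <-]].
  have [z <-] := hclass_surj h; rewrite homology_mapE => /hclass_eq0[w'' /= dw''].
  have [w pw] := p_surj w''.
  (* Subtracting a boundary keeps the class and makes the image in [C''] vanish exactly, not just up
     to a boundary. *)
  have : p n (cycle_val C n z - cx_d C n w) = 0 by rewrite linearB -cxm_d pw dw'' subrr.
  move=> /jpE[x jx].
  have Zx : x \in cycles C' n.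
    apply: (cycles_inj j_inj); rewrite jx submodB ?boundary_cycle //.
    exact: cycle_valP.
  exists (hclass C' n (mk_cycle Zx)); rewrite [LHS]homology_mapE.
  apply/eqP; rewrite -subr_eq0 -linearB; apply/eqP/hclass_eq0.
  by exists (- w); rewrite linearN /= jx addrC addKr.
have [z <-] := hclass_surj h'; rewrite !homology_mapE; apply/hclass_eq0.
by exists 0; rewrite linear0 /= pj.
Qed.

(** In degree 0 every chain is a cycle, so a lift of chains is a lift of classes. *)
Lemma homology_surj0 h'' : exists h, homology_map p 0 h = h''.
Proof.
have [z <-] := hclass_surj h''; have [y py] := p_surj (cycle_val C'' 0 z).
have Zy : y \in cycles C 0 by apply/mk_submodP.
exists (hclass C 0 (mk_cycle Zy)); rewrite [LHS]homology_mapE.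
by congr (hclass _ _ _); apply/cycle_val_inj.
Qed.

Definition snake_rel n (h'' : homology C'' n.+1) (h' : homology C' n) : Prop :=
  exists (y : C n.+1) z x, [/\ hclass C'' n.+1 z = h'', hclass C' n x = h',
    p n.+1 y = cycle_val C'' n.+1 z & j n (cycle_val C' n x) = cx_d C n y].

Lemma connecting_ex n : exists d : {linear homology C'' n.+1 -> homology C' n},
  forall h'' h', d h'' = h' <-> snake_rel h'' h'.
Proof.
apply: linear_of_rel => [h''|h' [y [z [x [z0 <- py jx]]]]|].
- have [z <-] := hclass_surj h''; have [y py] := p_surj (cycle_val C'' n.+1 z).
  have : p n (cx_d C n y) = 0.
    by rewrite -cxm_d py; have /mk_submodP := cycle_valP z.
  move=> /jpE[x jx]; have Zx : x \in cycles C' n.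
    by apply: (cycles_inj j_inj); rewrite jx boundary_cycle.
  by exists (hclass C' n (mk_cycle Zx)), y, z, (mk_cycle Zx).
(* Well-definedness over 0: if [z] bounds [w''], lifting [w''] to [w] puts [y] minus the boundary of
   [w] in the image of [j], and its preimage [v] bounds [x]. *)
- have [w'' dw''] := (hclass_eq0 z).1 z0; have [w pw] := p_surj w''.
  have : p n.+1 (y - cx_d C n.+1 w) = 0 by rewrite linearB py -cxm_d pw dw'' subrr.
  move=> /jpE[v jv]; apply/hclass_eq0; exists v; apply: j_inj.
  by rewrite -cxm_d jv linearB cx_dd subr0 jx.
move=> a _ _ _ _ [y [z [x [<- <- py jx]]]] [y' [z' [x' [<- <- py' jx']]]].
exists (a *: y + y'), (a *: z + z'), (a *: x + x').
split; [exact: linearP | exact: linearP | by rewrite !linearP py py' |].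
by rewrite !linearP jx jx'.
Qed.

Definition connecting n : {linear homology C'' n.+1 -> homology C' n} :=
  sval (cid (connecting_ex n)).

Lemma connectingP n h'' h' : connecting n h'' = h' <-> snake_rel h'' h'.
Proof. by rewrite /connecting; case: cid. Qed.

Lemma connecting_exact n : exact_at (homology_map p n.+1) (connecting n).
Proof.
move=> h''; split=> [/connectingP[y [z [x [<- /hclass_eq0[w dw] py jx]]]]|[h <-]].
  (* As [x] bounds [w], this correction turns the lift [y] into a cycle with the same image under
     [p]. *)
  have Zy : y - j n.+1 w \in cycles C n.+1.
    by apply/mk_submodP; rewrite linearB cxm_d dw jx subrr.
  exists (hclass C n.+1 (mk_cycle Zy)); rewrite [LHS]homology_mapE.
  by congr (hclass _ _ _); apply/cycle_val_inj; rewrite /= linearB pj subr0.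
have [y <-] := hclass_surj h; rewrite homology_mapE; apply/connectingP.
exists (cycle_val C n.+1 y), (cycle_map p n.+1 y), 0; split=> //; first exact: linear0.
by have /mk_submodP -> := cycle_valP y; exact: linear0.
Qed.

Lemma exact_connecting n : exact_at (connecting n) (homology_map j n).
Proof.
move=> h'; split=> [|[h'' /connectingP[y [z [x [_ <- _ jx]]]]]]; last first.
  by rewrite homology_mapE; apply/hclass_eq0; exists y.
have [x <-] := hclass_surj h'; rewrite homology_mapE => /hclass_eq0[y /= dy].
have Zy : p n.+1 y \in cycles C'' n.+1.
  by apply/mk_submodP; rewrite cxm_d dy pj.
exists (hclass C'' n.+1 (mk_cycle Zy)); apply/connectingP.
by exists y, (mk_cycle Zy), x.
Qed.

End ShortExact.

(** The vertical maps carry witnesses of [snake_rel] to witnesses of [snake_rel]. *)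
Lemma connecting_nat (C' C C'' D' D D'' : complex R)
    (j : cxmap C' C) (p : cxmap C C'') (k : cxmap D' D) (q : cxmap D D'')
    (jp : forall n, short_exact (j n) (p n)) (kq : forall n, short_exact (k n) (q n))
    (f' : cxmap C' D') (f : cxmap C D) (f'' : cxmap C'' D'') :
    (forall n x, k n (f' n x) = f n (j n x)) ->
    (forall n x, q n (f n x) = f'' n (p n x)) ->
  forall n h, homology_map f' n (connecting jp n h) =
              connecting kq n (homology_map f'' n.+1 h).
Proof.
move=> kf qf n h; have /connectingP[y [z [x [<- <- py jx]]]] := erefl (connecting jp n h).
apply/esym/connectingP; exists (f n.+1 y), (cycle_map f'' n.+1 z), (cycle_map f' n x).
split; rewrite ?homology_mapE //; first by rewrite qf py.
by rewrite /= kf jx cxm_d.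
Qed.

End Snake.

(** * The long exact Tor sequence in the second argument *)

Section TorSequence.
Variable R : comNzRingType.

Lemma syz_map_id (A : lmodType R) n : syz_map (idfun : {linear A -> A}) n =1 id.
Proof.
by elim: n => [|n IH] // x; apply/val_inj; exact: free_map_id IH _.
Qed.

Lemma res_map_id (A : lmodType R) n : res_map (idfun : {linear A -> A}) n =1 id.
Proof. exact: free_map_id (@syz_map_id A n). Qed.

Section ShortExact.
Variables (A N' N N'' : lmodType R) (j : {linear N' -> N}) (p : {linear N -> N''}).
Hypothesis jp : short_exact j p.

Lemma tens_res_exact n : short_exact (tens_cxmap (res_map (idfun : {linear A -> A})) j n)
  (tens_cxmap (res_map (idfun : {linear A -> A})) p n).
Proof. exact: tens_free_exact (@res_map_id A n) jp. Qed.

Definition Tor_connecting i : {linear Tor i.+1 A N'' -> Tor i A N'} :=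
  connecting tens_res_exact i.

Lemma Tor_exact i : exact_at (Tor_map i (idfun : {linear A -> A}) j)
  (Tor_map i (idfun : {linear A -> A}) p).
Proof. exact: homology_exact tens_res_exact i. Qed.

Lemma Tor_surj0 t : exists u, Tor_map 0 (idfun : {linear A -> A}) p u = t.
Proof. exact: homology_surj0 tens_res_exact t. Qed.

Lemma Tor_connecting_exact i :
  exact_at (Tor_map i.+1 (idfun : {linear A -> A}) p) (Tor_connecting i).
Proof. exact: connecting_exact. Qed.

Lemma Tor_exact_connecting i :
  exact_at (Tor_connecting i) (Tor_map i (idfun : {linear A -> A}) j).
Proof. exact: exact_connecting. Qed.

End ShortExact.

(** Used twice: with [e] the map R/m^(s+1) -> R/m^s for the limit over s, and with [e] the identity
    for maps between short exact sequences. *)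
Lemma Tor_connecting_nat (A B N' N N'' P' P P'' : lmodType R)
    (j : {linear N' -> N}) (p : {linear N -> N''})
    (k : {linear P' -> P}) (q : {linear P -> P''})
    (jp : short_exact j p) (kq : short_exact k q) (e : {linear A -> B})
    (f' : {linear N' -> P'}) (f : {linear N -> P}) (f'' : {linear N'' -> P''}) :
    (forall x, k (f' x) = f (j x)) -> (forall x, q (f x) = f'' (p x)) ->
  forall i t, Tor_map i e f' (Tor_connecting A jp i t) =
              Tor_connecting B kq i (Tor_map i.+1 e f'' t).
Proof.
move=> kf qf; have eid n := @res_map_square R A B A B e (idfun : {linear B -> B})
  (idfun : {linear A -> A}) e (fun=> erefl) n.
apply: (connecting_nat _ _ (f := tens_cxmap (res_map e) f)) => n.
  exact: tens_map_square (eid n) kf.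
exact: tens_map_square (eid n) qf.
Qed.

End TorSequence.

(** * Artinianness of Tor *)

Section Comparison.
Variable R : comNzRingType.

Lemma free_section (X : choiceType) (U V : lmodType R) (d : {linear U -> V})
    (f : {linear freem R X -> V}) :
    (forall x, exists u, d u = f x) ->
  exists g : {linear freem R X -> U}, forall x, d (g x) = f x.
Proof.
move=> df; have /choice[u du] (x : X) : exists u, d u = f (freeb R x) by exact: df.
exists (free_lift u); apply: (@free_ext R X V (d \o free_lift u) f) => x.
suff : d (free_lift u (freeb R x)) = f (freeb R x) by [].
by rewrite free_liftE du.
Qed.

(** * Comparison of a free complex with an exact one *)

Section Acyclic.
Variables (D : complex R) (B : lmodType R) (eD : {linear D 0 -> B}).
Hypothesis eD0 : forall x, eD x = 0 -> exists y, cx_d D 0 y = x.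
Hypothesis D_exact : forall n x, cx_d D n x = 0 -> exists y, cx_d D n.+1 y = x.

(** Cycles of the augmented complex; unlike in [cycles], degree 0 gives the kernel of the
    augmentation. *)
Definition resolution_cycle n : D n -> Prop :=
  if n is k.+1 return D n -> Prop then fun x => cx_d D k x = 0 else fun x => eD x = 0.

Lemma resolution_boundary n x : resolution_cycle x -> exists y, cx_d D n y = x.
Proof. by case: n x => [|n] x; [exact: eD0 | exact: D_exact]. Qed.

Variables (C : complex R) (X : nat -> choiceType).
Hypothesis C_free : forall n, C n = freem R (X n).

Lemma cx_free_section n (V W : lmodType R) (d : {linear V -> W})
    (f : {linear C n -> W}) :
    (forall x, exists u, d u = f x) ->
  exists g : {linear C n -> V}, forall x, d (g x) = f x.
Proof. by move: (C n) (C_free n) f => _ -> f; exact: free_section. Qed.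

Lemma comparison_lift (eC : {linear C 0 -> B}) :
    (forall y, exists x, eD x = y) -> (forall x, eC (cx_d C 0 x) = 0) ->
  exists f : cxmap C D, forall x, eD (f 0 x) = eC x.
Proof.
move=> eD_surj eCd.
(* The invariant makes the next lifting problem solvable; its clause for [n = 0] retains
   compatibility with the augmentations. *)
have [||f f_cyc f_d] := @dependent_choice (fun n => {linear C n -> D n})
  (fun n f => (forall x, resolution_cycle (f (cx_d C n x))) /\
     (if n is 0 return ({linear C n -> D n} -> Prop)
      then fun f => forall x, eD (f x) = eC x else fun=> True) f)
  (fun n f f' => forall x, cx_d D n (f' x) = f (cx_d C n x)).
- have [|f0 hf0] := @cx_free_section 0 _ _ eD eC; first by move=> x; exact: eD_surj.
  by exists f0; split=> // x; rewrite /= hf0 eCd.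
- move=> n f [f_cyc _]; have [x|f' hf'] := @cx_free_section n.+1 _ _ (cx_d D n)
    (f \o cx_d C n); first exact: resolution_boundary (f_cyc x).
  exists f' => //; split=> // x; rewrite /= hf' /= cx_dd; exact: linear0.
by exists (CxMap f_d) => x; case: (f_cyc 0) => _; exact.
Qed.

(** A chain map lifting 0 is null-homotopic: at each stage [g] minus the previous homotopy composed
    with the differential takes values in cycles, which bound by exactness. *)
Lemma comparison_homotopy (g : cxmap C D) :
    (forall x, eD (g 0 x) = 0) ->
  exists h : forall n, {linear C n -> D n.+1},
    (forall x, cx_d D 0 (h 0 x) = g 0 x) /\
    forall n x, cx_d D n.+1 (h n.+1 x) = g n.+1 x - h n (cx_d C n x).
Proof.
move=> eg.
have [||h h_cyc h_d] := @dependent_choice (fun n => {linear C n -> D n.+1})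
  (fun n h => (forall x, cx_d D n (h (cx_d C n x)) = g n (cx_d C n x)) /\
     (if n is 0 return ({linear C n -> D n.+1} -> Prop)
      then fun h => forall x, cx_d D 0 (h x) = g 0 x else fun=> True) h)
  (fun n h h' => forall x, cx_d D n.+1 (h' x) = g n.+1 x - h (cx_d C n x)).
- have [x|h0 hh0] := @cx_free_section 0 _ _ (cx_d D 0) (g 0); first exact/eD0/eg.
  by exists h0.
- move=> n h [h_cyc _]; have [x|h' hh'] := @cx_free_section n.+1 _ _ (cx_d D n.+1)
    (g n.+1 \- (h \o cx_d C n)).
    by apply: D_exact; rewrite linearB /= cxm_d h_cyc subrr.
  exists h' => //; split=> // x; rewrite hh' /= cx_dd.
  by rewrite [X in _ - X]linear0 subr0.
exists h; split=> //; case: (h_cyc 0) => _; exact.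
Qed.

End Acyclic.

Section Retraction.
Variables (C D : complex R) (N : lmodType R) (f : cxmap D C) (g : cxmap C D).
Variable h : forall n, {linear C n -> C n.+1}.
Hypothesis h0 : forall x, cx_d C 0 (h 0 x) = f 0 (g 0 x) - x.
Hypothesis hS : forall n x,
  cx_d C n.+1 (h n.+1 x) = f n.+1 (g n.+1 x) - x - h n (cx_d C n x).

(** The tensored homotopy makes the composite of [g] and [f] act as the identity on homology, so the
    image of [t] under [g] is a preimage. *)
Lemma tens_homotopy_surj n (t : homology (tens_cx C N) n) :
  exists s, homology_map (tens_cxmap f (idfun : {linear N -> N})) n s = t.
Proof.
exists (homology_map (tens_cxmap g (idfun : {linear N -> N})) n t).
have [z <-] := hclass_surj t; rewrite !homology_mapE.
apply/eqP; rewrite -subr_eq0 -linearB; apply/eqP/hclass_eq0.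
exists (tens_map (h n) (idfun : {linear N -> N}) (cycle_val _ n z)).
rewrite linearB !cycle_mapE.
(* The last term is the homotopy after the differential; it is absent in degree 0 and vanishes on
   cycles. *)
have tens_eq (u : tens_cx C N n) : cx_d (tens_cx C N) n (tens_map (h n) idfun u) =
    tens_map (f n) idfun (tens_map (g n) idfun u) - u -
    (if n is k.+1 return tens_cx C N n -> tens_cx C N n
     then fun u => tens_map (h k) idfun (cx_d (tens_cx C N) k u) else fun=> 0) u.
  clear z t; case: n u => [|n] u.
    rewrite subr0.
    apply: (@tens_ext R _ _ _ (cx_d (tens_cx C N) 0 \o tens_map (h 0) idfun)
      ((tens_map (f 0) idfun \o tens_map (g 0) idfun) \- idfun)) => a x.
    suff : tens_map (cx_d C 0) idfun (tens_map (h 0) idfun (tensor a x)) =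
      tens_map (f 0) idfun (tens_map (g 0) idfun (tensor a x)) - tensor a x by [].
    by rewrite !tens_mapE h0; apply/eqP; rewrite eq_sym subr_eq -tensorDl subrK.
  apply: (@tens_ext R _ _ _ (cx_d (tens_cx C N) n.+1 \o tens_map (h n.+1) idfun)
    (((tens_map (f n.+1) idfun \o tens_map (g n.+1) idfun) \- idfun) \-
      (tens_map (h n) idfun \o cx_d (tens_cx C N) n))) => a x.
  suff : tens_map (cx_d C n.+1) idfun (tens_map (h n.+1) idfun (tensor a x)) =
    tens_map (f n.+1) idfun (tens_map (g n.+1) idfun (tensor a x)) - tensor a x -
    tens_map (h n) idfun (tens_map (cx_d C n) idfun (tensor a x)) by [].
  by rewrite !tens_mapE hS; apply/eqP; rewrite eq_sym !subr_eq -!tensorDl !subrK.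
rewrite tens_eq; have := cycle_valP z; case: (n) (cycle_val _ _ z) => [|k] u.
  by rewrite subr0.
by move=> /mk_submodP ->; rewrite [X in _ - X]linear0 subr0.
Qed.

End Retraction.

Lemma homology_artinian (C : complex R) n : artinian (C n) -> artinian (homology C n).
Proof.
move=> artC; apply: (artinian_surj (f := hclass C n)) (artinian_sub artC).
exact: hclass_surj.
Qed.

Lemma tens_fin_artinian n (N : lmodType R) :
  artinian N -> artinian (tens (freem R 'I_n) N).
Proof.
(* [artinian_joint_inj] takes maps indexed by all of [nat]; those out of range are set to 0. *)
move=> artN; apply: (@artinian_joint_inj R n _ N (fun k =>
  if insub k is Some i then tens_coord (i : 'I_n) else \0)) => // u hu.
by apply: tens_coord_eq0 => i; have := hu i (ltn_ord i); rewrite valK.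
Qed.

Definition finitely_generated (A : lmodType R) : Prop :=
  exists s : seq A, forall x, x \in span_seq s.

(** * Resolutions by finite free modules *)

Section FiniteResolution.
Hypothesis noethR : noetherian_ring R.

Lemma finite_cover (A : lmodType R) : finitely_generated A ->
  exists k, exists e : {linear freem R 'I_k -> A}, forall y, exists x, e x = y.
Proof.
case=> s sA; exists (size s), (free_lift (fun i : 'I_(size s) => nth 0 s i)) => y.
suff /mk_submodP : y \in iml (free_lift (fun i : 'I_(size s) => nth 0 s i)) by [].
move: y (sA y); apply: span_seq_min => _ /(nthP 0)[i si <-]; apply/mk_submodP.
by exists (freeb R (Ordinal si)); rewrite free_liftE.
Qed.

Lemma kerl_finitely_generated k (A : lmodType R) (e : {linear freem R 'I_k -> A}) :
  finitely_generated (submod (kerl e)).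
Proof.
have [|s hs] := @noetherian_span R _ [seq freeb R i | i <- enum 'I_k] (kerl e) noethR.
  move=> D _; apply: freem_ind => i; apply: span_seq_mem.
  by apply: map_f; rewrite mem_enum.
have sK : {subset s <= kerl e} by move=> x sx; rewrite hs span_seq_mem.
exists (pmap insub s) => -[x Kx].
have Pprop : submod_prop (fun x => exists2 y : submod (kerl e),
    y \in span_seq (pmap insub s) & val y = x).
  split=> [|a u v [y sy <-] [z sz <-]]; first by exists 0; rewrite ?rpred0.
  by exists (a *: y + z); rewrite ?rpredD ?rpredZ // linearP.
have : x \in mk_submod Pprop.
  rewrite hs in Kx; move: x Kx; apply: span_seq_min => x sx; apply/mk_submodP.
  exists (exist _ x (sK x sx)) => //; apply: span_seq_mem.
  by rewrite mem_pmap_sub.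
by move=> /mk_submodP[y sy yx]; rewrite (_ : exist _ _ _ = y) //; apply/val_inj.
Qed.

(** Bundling the finiteness proof lets the recursion [fin_syz] choose a finite cover of each
    syzygy. *)
Definition fgmod : Type := {A : lmodType R | finitely_generated A}.

Definition fin_rank (A : fgmod) : nat := sval (cid (finite_cover (svalP A))).

Definition fin_cover (A : fgmod) : {linear freem R 'I_(fin_rank A) -> sval A} :=
  sval (cid (svalP (cid (finite_cover (svalP A))))).

Lemma fin_cover_surj (A : fgmod) y : exists x, fin_cover A x = y.
Proof. exact: (svalP (cid (svalP (cid (finite_cover (svalP A)))))). Qed.

Fixpoint fin_syz (A : fgmod) (n : nat) : fgmod :=
  if n is k.+1 then exist _ _ (kerl_finitely_generated (fin_cover (fin_syz A k)))
  else A.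

Definition fin_res_d (A : fgmod) n :
    {linear freem R 'I_(fin_rank (fin_syz A n.+1)) ->
            freem R 'I_(fin_rank (fin_syz A n))} :=
  incl (kerl (fin_cover (fin_syz A n))) \o fin_cover (fin_syz A n.+1).

Lemma fin_res_d0 (A : fgmod) n x :
  fin_cover (fin_syz A n) (fin_res_d A n x) = 0.
Proof. by have /mk_submodP := valP (fin_cover (fin_syz A n.+1) x). Qed.

Lemma fin_res_dd (A : fgmod) n x : fin_res_d A n (fin_res_d A n.+1 x) = 0.
Proof.
rewrite -[LHS]/(val (fin_cover (fin_syz A n.+1) (fin_res_d A n.+1 x))).
by rewrite fin_res_d0.
Qed.

Lemma fin_res_exact (A : fgmod) n (x : freem R 'I_(fin_rank (fin_syz A n))) :
  fin_cover (fin_syz A n) x = 0 -> exists y, fin_res_d A n y = x.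
Proof.
move=> ex; have Kx : x \in kerl (fin_cover (fin_syz A n)) by apply/mk_submodP.
have [y ey] := fin_cover_surj (exist _ x Kx : sval (fin_syz A n.+1)).
by exists y; rewrite -[LHS]/(val (fin_cover (fin_syz A n.+1) y)) ey.
Qed.

Definition fin_res (A : fgmod) : complex R := Complex (@fin_res_dd A).

(** [Tor] is computed by the functorial resolution, whose terms need not have finite rank.
    Comparison maps with [fin_res] present it as a quotient of the homology of a complex of modules
    N^k. *)
Lemma Tor_artinian i (A N : lmodType R) :
  finitely_generated A -> artinian N -> artinian (Tor i A N).
Proof.
move=> fgA artN; pose B : fgmod := exist _ A fgA; pose P := fin_res B.
have P_exact0 (x : P 0) : fin_cover B x = 0 -> exists y, cx_d P 0 y = x.
  exact: (@fin_res_exact B 0 x).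
have P_exact n (x : P n.+1) : cx_d P n x = 0 -> exists y, cx_d P n.+1 y = x.
  by move=> dx; apply: (@fin_res_exact B n.+1); apply/val_inj.
have [f fE] : exists f : cxmap P (res A), forall x, aug A (f 0 x) = fin_cover B x.
  apply: (@comparison_lift (res A) A (aug A) (@res_exact0 R A) (@res_exact R A) P
    _ (fun n => erefl)); first exact: aug_surj.
  exact: (@fin_res_d0 B 0).
have aug_d x : aug A (cx_d (res A) 0 x) = 0.
  by have /mk_submodP := valP (aug (syz A 1) x).
have [g gE] : exists g : cxmap (res A) P, forall x, fin_cover B (g 0 x) = aug A x.
  apply: (@comparison_lift P A (fin_cover B) P_exact0 P_exact (res A)
    _ (fun n => erefl)); first exact: (@fin_cover_surj B).
  exact: aug_d.
have fg_d n x : cx_d (res A) n (f n.+1 (g n.+1 x) - x) =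
    f n (g n (cx_d (res A) n x)) - cx_d (res A) n x by rewrite linearB !cxm_d.
(* The round trip minus the identity lifts 0 on [A], hence is null-homotopic. *)
pose fg : cxmap (res A) (res A) :=
  @CxMap R (res A) (res A) (fun n => (f n \o g n) \- idfun) fg_d.
have [|h [h0 hS]] := @comparison_homotopy (res A) A (aug A) (@res_exact0 R A)
    (@res_exact R A) (res A) _ (fun n => erefl) fg.
  by move=> x; rewrite -[fg 0 x]/(f 0 (g 0 x) - x) linearB fE gE subrr.
apply: (artinian_surj (f := homology_map (tens_cxmap f (idfun : {linear N -> N})) i)).
  exact: (tens_homotopy_surj h0 hS).
by apply: homology_artinian; exact: tens_fin_artinian.
Qed.

End FiniteResolution.

End Comparison.

(** * Inverse limits and local homology *)

Section InverseLimits.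
Variable R : comNzRingType.

(* The iterated transition map X n -> X k; it is 0 when n < k. *)
Fixpoint inv_shift (X : invsys R) (k n : nat) : X n -> X k :=
  match n =P k with
  | ReflectT e => fun x => ecast k (X k) e x
  | ReflectF _ => match n return X n -> X k with
                  | 0 => fun=> 0
                  | n'.+1 => fun x => @inv_shift X k n' (inv_tr X n' x)
                  end
  end.

Arguments inv_shift X k {n} x.

Section Shift.
Variable X : invsys R.

Lemma inv_shiftnn n (x : X n) : inv_shift X n x = x.
Proof. by case: n x => [|n] x /=; case: eqP => // e; rewrite eq_axiomK. Qed.

Lemma inv_shiftS k n (x : X n.+1) : (k <= n)%N ->
  inv_shift X k x = inv_shift X k (inv_tr X n x).
Proof. by move=> kn /=; case: eqP => // e; rewrite -e ltnn in kn. Qed.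

Lemma inv_shift_tr k n (x : X n) : (k < n)%N ->
  inv_tr X k (inv_shift X k.+1 x) = inv_shift X k x.
Proof.
elim: n x => [|n IH] x //; rewrite ltnS leq_eqVlt => /predU1P[kn|kn].
  by subst k; rewrite inv_shiftnn inv_shiftS // inv_shiftnn.
by rewrite !inv_shiftS ?IH // ltnW.
Qed.

Lemma inv_shift_linear k n : linear (@inv_shift X k n).
Proof.
elim: n => [|n IH] a x y /=; case: eqP => e.
- by case: _ / e.
- by rewrite scaler0 addr0.
- by case: _ / e.
by rewrite linearP IH.
Qed.

End Shift.

Section Exact.
Variables (X Y Z : invsys R).
Variables (a : forall n, {linear X n -> Y n}) (b : forall n, {linear Y n -> Z n}).
Hypothesis a_tr : forall n x, a n (inv_tr X n x) = inv_tr Y n (a n.+1 x).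
Hypothesis b_tr : forall n x, b n (inv_tr Y n x) = inv_tr Z n (b n.+1 x).

(* Mittag-Leffler: the fibres over a compatible family are cosets of          *)
(* submodules of artinian modules, hence their images stabilize.              *)
Lemma invlim_lift (y : dprod Y) : (forall n, artinian (X n)) ->
    (forall n, inv_tr Y n (y n.+1) = y n) -> (forall n, exists x, a n x = y n) ->
  exists2 x : dprod X, (forall n, inv_tr X n (x n.+1) = x n) & forall n, a n (x n) = y n.
Proof.
move=> artX y_tr ay.
(* [P s n] is the image in [X s] of the fibre over [y n]; [K s n] is the submodule of which it is a
   coset. *)
pose P s n (x : X s) := exists2 z, a n z = y n & inv_shift X s z = x.
pose K s n := im_submod (mk_linear (@inv_shift_linear X s n)) (kerl (a n)).
have P_dec s n k x : (s <= n)%N -> (n <= k)%N -> P s k x -> P s n x.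
  move=> sn /subnK<-; elim: (k - n)%N => [|d IH] //= [z az zx].
  apply: IH; exists (inv_tr X _ z); first by rewrite a_tr az y_tr.
  by rewrite -inv_shiftS // (leq_trans sn) ?leq_addl.
have [N sN hN] : exists2 N : nat -> nat, forall s, (s <= N s)%N &
    forall s n, (N s <= n)%N -> K s n =i K s (N s).
  suff /choice[N hN] s : exists N, (s <= N)%N /\ forall n, (N <= n)%N -> K s n =i K s N.
    by exists N => s; have [] := hN s.
  have [|d hd] := artX s (fun d => K s (d + s)%N).
    move=> d x /im_submodP[z /mk_submodP az <-]; apply/im_submodP.
    exists (inv_tr X _ z); last by rewrite /= -inv_shiftS // leq_addl.
    by apply/mk_submodP; rewrite a_tr az linear0.
  exists (d + s)%N; split; first exact: leq_addl.
  move=> n dn; have sn := leq_trans (leq_addl d s) dn.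
  by rewrite -(subnK sn); apply: hd; rewrite leq_subRL // addnC.
(* For n beyond [N s], the cosets at n and [N s] are nested with the same direction submodule, so
   they coincide. *)
have P_stable s n x : P s (N s) x -> (s <= n)%N -> P s n x.
  move=> Px sn; case: (leqP n (N s)) => [nN|/ltnW Nn]; first exact: P_dec Px.
  have [z az] := ay n; have Pz : P s n (inv_shift X s z) by exists z.
  have [v av vz] := P_dec _ _ _ _ (sN s) Nn Pz; have [w aw wx] := Px.
  have : x - inv_shift X s z \in K s n.
    rewrite hN //; apply/im_submodP; exists (w - v).
      by apply/mk_submodP; rewrite linearB av aw subrr.
    by rewrite linearB /= wx vz.
  move=> /im_submodP[u /mk_submodP au /= ux]; exists (u + z).
    by rewrite linearD au az add0r.
  by rewrite -[LHS]/(mk_linear (@inv_shift_linear X s n) (u + z)) linearD /= ux subrK.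
have [||x Px x_tr] := @dependent_choice (fun s => X s) (fun s x => P s (N s) x)
  (fun s x x' => inv_tr X s x' = x).
- by have [z az] := ay (N 0%N); exists (inv_shift X 0 z), z.
(* Stability provides a witness at level [N s.+1]; its image in [X s.+1] is stable again and maps to
   [x]. *)
- move=> s x /P_stable/(_ (ltnW (sN s.+1)))[z az zx].
  exists (inv_shift X s.+1 z); first by exists z.
  by rewrite inv_shift_tr.
exists x => // n; have [z az <-] := P_stable _ _ _ (Px n) (leqnn n).
by rewrite inv_shiftnn.
Qed.

(** Exactness at each level makes all fibres over a compatible family nonempty, and [invlim_lift]
    picks a compatible point in them. *)
Lemma invlim_exact : (forall n, artinian (X n)) ->
    (forall n, exact_at (a n) (b n)) ->
  exact_at (invlim_map a_tr) (invlim_map b_tr).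
Proof.
move=> artX ab y; split=> [by0|[x <-]]; last first.
  apply/val_inj; apply: functional_extensionality_dep => n.
  by apply/(ab n); exists (val x n).
have /mk_submodP y_tr := valP y.
have [n|x x_tr ax] := invlim_lift artX y_tr.
  by apply/ab; have /(congr1 (fun u => sval u n)) := by0.
have Lx : x \in mk_submod (@compatible_prop R X) by apply/mk_submodP.
exists (exist _ x Lx); apply/val_inj; apply: functional_extensionality_dep => n.
exact: ax.
Qed.

End Exact.

End InverseLimits.

(** * Long exact sequences of local homology for artinian modules *)

Section LocalHomologySequence.
Variables (R : comNzRingType) (m : submodClosed R^o).
Hypothesis noethR : noetherian_ring R.

Lemma quot_pow_fg s : finitely_generated (quot_pow m s).
Proof.
exists [:: quot_pi (ideal_pow m s) 1] => q; rewrite -[q]quot_repK.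
have -> : quot_pi (ideal_pow m s) (quot_rep q) =
    (quot_rep q : R) *: quot_pi (ideal_pow m s) 1.
  by rewrite -linearZ; congr (quot_pi _ _); exact: esym (mulr1 _).
by rewrite rpredZ // span_seq_mem ?mem_head.
Qed.

Lemma local_homology_map_id i (N : lmodType R) (g : {linear N -> N}) h :
  g =1 id -> local_homology_map m i g h = h.
Proof.
move=> gE; apply/val_inj; apply: functional_extensionality_dep => s.
suff Tor_id (A : lmodType R) t : Tor_map i (idfun : {linear A -> A}) g t = t.
  exact: Tor_id.
have [z <-] := hclass_surj t; rewrite [LHS]homology_mapE.
congr (hclass _ _ _); apply: cycle_val_inj; rewrite cycle_mapE.
exact: (tens_map_free_id (@res_map_id R A i) gE).
Qed.

Lemma local_homology_map_comp i (N P Q : lmodType R) (g : {linear N -> P})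
    (g' : {linear P -> Q}) (g'' : {linear N -> Q}) h :
    (forall x, g' (g x) = g'' x) ->
  local_homology_map m i g' (local_homology_map m i g h) =
  local_homology_map m i g'' h.
Proof.
move=> gE.
rewrite -[RHS](@local_homology_map_id i Q idfun) //.
exact: local_homology_map_square.
Qed.

Section ShortExact.
Variables (N' N N'' : lmodType R) (j : {linear N' -> N}) (p : {linear N -> N''}).
Hypotheses (artN' : artinian N') (artN : artinian N) (jp : short_exact j p).

Let artN'' : artinian N''.
Proof. by case: jp => _ _ p_surj; exact: artinian_surj artN. Qed.

Let art i s (P : lmodType R) : artinian P -> artinian (local_homology_sys m i P s).
Proof. by apply: Tor_artinian => //; exact: quot_pow_fg. Qed.

Lemma local_homology_connecting_tr i s t :
  Tor_connecting (quot_pow m s) jp i (inv_tr (local_homology_sys m i.+1 N'') s t) =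
  inv_tr (local_homology_sys m i N') s (Tor_connecting (quot_pow m s.+1) jp i t).
Proof.
apply/esym; exact: (@Tor_connecting_nat R _ _ _ _ _ _ _ _ j p j p jp jp
  (quot_pow_tr m s) idfun idfun idfun (fun=> erefl) (fun=> erefl) i t).
Qed.

Definition local_homology_connecting i :
    {linear local_homology m i.+1 N'' -> local_homology m i N'} :=
  @invlim_map R (local_homology_sys m i.+1 N'') (local_homology_sys m i N')
    (fun s => Tor_connecting (quot_pow m s) jp i) (@local_homology_connecting_tr i).

Lemma local_homology_exact i :
  exact_at (local_homology_map m i j) (local_homology_map m i p).
Proof. by apply: invlim_exact => s; [exact: art | exact: Tor_exact]. Qed.

Lemma local_homology_connecting_exact i :
  exact_at (local_homology_map m i.+1 p) (local_homology_connecting i).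
Proof. by apply: invlim_exact => s; [exact: art | exact: Tor_connecting_exact]. Qed.

Lemma local_homology_exact_connecting i :
  exact_at (local_homology_connecting i) (local_homology_map m i j).
Proof. by apply: invlim_exact => s; [exact: art | exact: Tor_exact_connecting]. Qed.

Lemma local_homology_surj0 h : exists h', local_homology_map m 0 p h' = h.
Proof.
pose T := local_homology_sys m 0 N''.
have zero_tr s x : (\0 : {linear T s -> T s}) (inv_tr T s x) =
    inv_tr T s ((\0 : {linear T s.+1 -> T s.+1}) x).
  exact: esym (linear0 (inv_tr T s)).
(* Surjectivity is phrased as exactness before a zero map, so that [invlim_exact] applies. *)
have lim_exact : exact_at (local_homology_map m 0 p)
    (@invlim_map R T T (fun s => \0 : {linear T s -> T s}) zero_tr).
  apply: invlim_exact => s; first exact: art.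
  by move=> t; split=> // _; exact: (Tor_surj0 jp t).
by apply/lim_exact; apply/val_inj; apply: functional_extensionality_dep => s.
Qed.

End ShortExact.

Lemma local_homology_connecting_nat (N' N N'' P' P P'' : lmodType R)
    (j : {linear N' -> N}) (p : {linear N -> N''})
    (k : {linear P' -> P}) (q : {linear P -> P''})
    (jp : short_exact j p) (kq : short_exact k q)
    (f' : {linear N' -> P'}) (f : {linear N -> P}) (f'' : {linear N'' -> P''}) :
    (forall x, k (f' x) = f (j x)) -> (forall x, q (f x) = f'' (p x)) ->
  forall i h, local_homology_map m i f' (local_homology_connecting jp i h) =
              local_homology_connecting kq i (local_homology_map m i.+1 f'' h).
Proof.
move=> kf qf i h; apply/val_inj; apply: functional_extensionality_dep => s.
exact: (Tor_connecting_nat jp kq (idfun : {linear quot_pow m s -> quot_pow m s}) kf qf).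
Qed.

End LocalHomologySequence.

(** * Direct limits *)

Section DirectLimits.
Variable R : comNzRingType.

(* The iterated transition map X n -> X k; it is 0 when k < n. *)
Fixpoint dir_shift (X : dirsys R) (n : nat) (x : X n) (k : nat) : X k :=
  match n =P k with
  | ReflectT e => ecast k (X k) e x
  | ReflectF _ => match k return X k with
                  | 0 => 0
                  | k'.+1 => dir_tr X k' (@dir_shift X n x k')
                  end
  end.

Arguments dir_shift X {n} x k.

Section Shift.
Variable X : dirsys R.

Lemma dir_shiftnn n (x : X n) : dir_shift X x n = x.
Proof. by case: n x => [|n] x /=; case: eqP => // e; rewrite eq_axiomK. Qed.

Lemma dir_shiftS n k (x : X n) : (n <= k)%N ->
  dir_shift X x k.+1 = dir_tr X k (dir_shift X x k).
Proof. by move=> nk /=; case: eqP => // e; rewrite e ltnn in nk. Qed.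

Lemma dir_shift_tr n k (x : X n) : (n < k)%N ->
  dir_shift X (dir_tr X n x) k = dir_shift X x k.
Proof.
elim: k => [|k IH] //; rewrite ltnS leq_eqVlt => /predU1P[nk|nk].
  by subst k; rewrite dir_shiftnn dir_shiftS // dir_shiftnn.
by rewrite !dir_shiftS ?IH // ltnW.
Qed.

Lemma dir_shift_linear n k : linear (fun x : X n => dir_shift X x k).
Proof.
elim: k => [|k IH] a x y /=; case: eqP => e.
- by case: _ / e.
- by rewrite scaler0 addr0.
- by case: _ / e.
by rewrite IH linearP.
Qed.

Lemma dir_in_shift n k (x : X n) : (n <= k)%N -> dir_in (dir_shift X x k) = dir_in x.
Proof.
move=> /subnK<-; elim: (k - n)%N => [|d IH]; first by rewrite dir_shiftnn.
by rewrite addSn dir_shiftS ?leq_addl // dir_in_tr IH.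
Qed.

(** Two elements can be pushed to a common stage, so images of single stages already form a
    submodule; it contains the generators. *)
Lemma dirlim_surj (u : dirlim X) : exists n, exists x : X n, dir_in x = u.
Proof.
have dir_inL n a (x y : X n) : dir_in (a *: x + y) = a *: dir_in x + dir_in y.
  exact: dir_inP.
have Pprop : submod_prop (fun u : dirlim X => exists n, exists x : X n, dir_in x = u).
  split=> [|a _ _ [n [x <-]] [k [y <-]]].
    by exists 0, 0; exact: linear0 (mk_linear (@dir_inP R X 0)).
  exists (maxn n k), (a *: dir_shift X x (maxn n k) + dir_shift X y (maxn n k)).
  by rewrite dir_inL !dir_in_shift ?leq_maxl ?leq_maxr.
apply/(mk_submodP Pprop); rewrite -[u]quot_repK.
suff /mk_submodP : quot_rep u \in
  preim_submod (quot_pi (span (@dir_rel R X))) (mk_submod Pprop) by [].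
by apply: freem_ind => -[n x]; apply/mk_submodP/mk_submodP; exists n, x.
Qed.

Lemma eventually0_prop :
  submod_prop (fun u : dprod X => exists n, forall k, (n <= k)%N -> u k = 0).
Proof.
split=> [|a u v [n un] [k vk]]; first by exists 0.
exists (maxn n k) => l; rewrite geq_max => /andP[nl kl].
by rewrite -[LHS]/(a *: u l + v l) un // vk // scaler0 addr0.
Qed.

(* An element of X n determines its eventual sequence of iterated images;     *)
(* this embeds the direct limit into sequences modulo eventually zero ones.   *)
Lemma dir_in_eq0 n (x : X n) :
  dir_in x = 0 -> exists2 k, (n <= k)%N & dir_shift X x k = 0.
Proof.
pose S := mk_submod eventually0_prop.
pose f := free_lift (fun u : dir_elt X => quot_pi S
  ((fun k => dir_shift X (tagged u) k) : dprod X)).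
have fE k (y : X k) : f (freeb R (existT _ k y : dir_elt X)) =
    quot_pi S ((fun l => dir_shift X y l) : dprod X) by exact: free_liftE.
have f_rel u : u \in span (@dir_rel R X) -> f u = 0.
  suff /span_min h : forall y, @dir_rel R X y -> y \in kerl f.
    by move=> /h /mk_submodP.
  move=> _ [k a y z|k y]; apply/mk_submodP.
    rewrite linearB linearP !fE -linearP -linearB -(linear0 (quot_pi S)).
    apply/quot_piP; rewrite subr0; apply/mk_submodP; exists 0 => l _.
    by apply/eqP; rewrite subr_eq0; apply/eqP; exact: dir_shift_linear.
  rewrite linearB !fE -linearB -(linear0 (quot_pi S)).
  apply/quot_piP; rewrite subr0; apply/mk_submodP; exists k.+1 => l kl.
  by apply/eqP; rewrite subr_eq0; apply/eqP; exact: dir_shift_tr.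
have [g gE] := quot_lift f_rel; move=> x0.
have : quot_pi S ((fun l => dir_shift X x l) : dprod X) = 0.
  by rewrite -fE -gE -[quot_pi _ _]/(dir_in x) x0 linear0.
rewrite -(linear0 (quot_pi S)) => /quot_piP; rewrite subr0 => /mk_submodP[k xk].
by exists (maxn n k); rewrite ?leq_maxl // xk ?leq_maxr.
Qed.

End Shift.

Lemma dir_shift_map (X Y : dirsys R) (f : forall n, {linear X n -> Y n})
    (f_tr : forall n x, f n.+1 (dir_tr X n x) = dir_tr Y n (f n x)) n k (x : X n) :
  (n <= k)%N -> f k (dir_shift X x k) = dir_shift Y (f n x) k.
Proof.
move=> /subnK<-; elim: (k - n)%N => [|d IH]; first by rewrite !dir_shiftnn.
by rewrite addSn !dir_shiftS ?leq_addl // f_tr IH.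
Qed.

Section Exact.
Variables (X Y Z : dirsys R).
Variables (f : forall n, {linear X n -> Y n}) (g : forall n, {linear Y n -> Z n}).
Hypothesis f_tr : forall n x, f n.+1 (dir_tr X n x) = dir_tr Y n (f n x).
Hypothesis g_tr : forall n x, g n.+1 (dir_tr Y n x) = dir_tr Z n (g n x).

Lemma dirlim_exact : (forall n, exact_at (f n) (g n)) ->
  exact_at (dirlim_map f_tr) (dirlim_map g_tr).
Proof.
move=> fg v; split=> [|[u <-]].
  have [n [y <-]] := dirlim_surj v; rewrite dirlim_mapE => /dir_in_eq0[k nk].
  rewrite -(dir_shift_map g_tr) // => /fg[x fx]; exists (dir_in x).
  by rewrite dirlim_mapE fx dir_in_shift.
have [n [x <-]] := dirlim_surj u; rewrite !dirlim_mapE.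
have -> : g n (f n x) = 0 by apply/fg; exists x.
exact: linear0 (mk_linear (@dir_inP R Z n)).
Qed.

Lemma dirlim_map_surj : (forall n y, exists x, f n x = y) ->
  forall v, exists u, dirlim_map f_tr u = v.
Proof.
move=> f_surj v; have [n [y <-]] := dirlim_surj v; have [x <-] := f_surj n y.
by exists (dir_in x); rewrite dirlim_mapE.
Qed.

(** The maps [h] invert [f] up to transition maps, which become invisible in the limit. *)
Lemma dirlim_interleave :
    (forall n, exists k, (n <= k)%N /\ exists h : {linear Y n -> X k},
      (forall y, f k (h y) = dir_shift Y y k) /\
      (forall x, h (f n x) = dir_shift X x k)) ->
  injective (dirlim_map f_tr) /\ forall v, exists u, dirlim_map f_tr u = v.
Proof.
move=> fh; split=> [u v|v]; last first.
  have [n [y <-]] := dirlim_surj v; have [k [nk [h [fhE _]]]] := fh n.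
  by exists (dir_in (h y)); rewrite dirlim_mapE fhE dir_in_shift.
move=> /eqP; rewrite -subr_eq0 -linearB => /eqP uv.
apply/eqP; rewrite -subr_eq0; move: (u - v) uv => {u v} u.
have [n [x <-]] := dirlim_surj u; rewrite dirlim_mapE => /dir_in_eq0[k nk].
rewrite -(dir_shift_map f_tr) // => fx0; have [l [kl [h [_ hf]]]] := fh k.
rewrite -(dir_in_shift x nk) -(dir_in_shift _ kl) -hf fx0 linear0; apply/eqP.
exact: linear0 (mk_linear (@dir_inP R X l)).
Qed.

End Exact.

End DirectLimits.

Arguments dir_shift {R} X {n} x k.

(** * Formal local homology *)

Section ExactTransport.
Variable R : comNzRingType.

Lemma exact_at_inj (U V W W' : lmodType R) (f : {linear U -> V})
    (g : {linear V -> W}) (h : {linear W -> W'}) (g' : {linear V -> W'}) :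
    injective h -> (forall v, h (g v) = g' v) -> exact_at f g -> exact_at f g'.
Proof.
move=> h_inj hg fg v; rewrite -hg -(fg v); split=> [|->]; last exact: linear0.
by rewrite -(linear0 h) => /h_inj.
Qed.

(** [d'] is [d] after the inverse of the bijection [h], obtained from its graph. *)
Lemma exact_at_bij (V W W' T T' : lmodType R) (g : {linear V -> W})
    (d : {linear W -> T}) (f : {linear T -> T'}) (h : {linear W -> W'})
    (g' : {linear V -> W'}) :
    injective h -> (forall w', exists w, h w = w') -> (forall v, h (g v) = g' v) ->
    exact_at g d -> exact_at d f ->
  exists d' : {linear W' -> T}, exact_at g' d' /\ exact_at d' f.
Proof.
move=> h_inj h_surj hg gd df.
have [||a u u' v v'|d' dE] := @linear_of_rel R W' T
  (fun u v => exists2 w, h w = u & d w = v).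
- by move=> u; have [w <-] := h_surj u; exists (d w), w.
- by move=> v [w w0 <-]; rewrite (h_inj w 0) ?linear0.
- by move=> [w <- <-] [w' <- <-]; exists (a *: w + w'); exact: linearP.
have dh w : d' (h w) = d w by apply/dE; exists w.
exists d'; split=> v.
  have [w <-] := h_surj v; rewrite dh (gd w).
  split=> -[u uw]; exists u; first by rewrite -hg uw.
  by apply: h_inj; rewrite -uw -hg.
rewrite (df v); split=> -[w <-]; first by exists (h w).
by have [u <-] := h_surj w; exists u; rewrite dh.
Qed.

End ExactTransport.

Section FormalSequence.
Variables (R : comNzRingType) (m I : submodClosed R^o).
Hypothesis noethR : noetherian_ring R.

Lemma ideal_pow_le n k : (n <= k)%N -> {subset ideal_pow I k <= ideal_pow I n}.
Proof.
move=> /subnK<-; elim: (k - n)%N => [|d IH] x // Ix.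
by apply: IH; exact: ideal_powS.
Qed.

Lemma ann_le (U : lmodType R) n k x : (n <= k)%N ->
  x \in ann U (ideal_pow I n) -> x \in ann U (ideal_pow I k).
Proof.
move=> nk /mk_submodP hx; apply/mk_submodP => a Ja; apply: hx.
exact: ideal_pow_le Ja.
Qed.

Section Filtration.
Variables (U : lmodType R) (S : nat -> submodClosed U).
Hypothesis S_inc : forall n x, x \in S n -> x \in S n.+1.

(** This form covers both [formal_sys] of M'' and [im_sys], so [filtration_shift] computes iterated
    transition maps for both. *)
Definition filtration_sys i : dirsys R :=
  @DirSys R (fun n => local_homology m i (submod (S n)))
    (fun n => local_homology_map m i (sub_map (f := idfun) (@S_inc n))).

Lemma filtration_shift i n k (nk : forall x, x \in S n -> x \in S k)
    (h : filtration_sys i n) : (n <= k)%N ->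
  dir_shift (filtration_sys i) h k = local_homology_map m i (sub_map (f := idfun) nk) h.
Proof.
elim: k nk => [|k IH] nk; rewrite leq_eqVlt => /predU1P[e|].
- by subst n; rewrite dir_shiftnn local_homology_map_id // => x; exact: val_inj.
- by [].
- by subst n; rewrite dir_shiftnn local_homology_map_id // => x; exact: val_inj.
rewrite ltnS => le_nk; rewrite dir_shiftS //.
have nk' x : x \in S n -> x \in S k.
  by move: x; elim: (k) le_nk => [|l IHl];
    [case: (n) | rewrite leq_eqVlt => /predU1P[->|/IHl h'] // x /h'/S_inc].
rewrite (IH nk') //; apply: local_homology_map_comp => x; exact: val_inj.
Qed.

End Filtration.

Variables (M' M M'' : lmodType R) (f : {linear M' -> M}) (g : {linear M -> M''}).
Hypotheses (artM' : artinian M') (artM : artinian M) (fg : short_exact f g).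

Let J := ideal_pow I.

(* The functor 0 :_(-) I^t is only left exact, so M'' must be filtered by the *)
(* images of the 0 :_M I^t rather than by the 0 :_M'' I^t.                    *)
Definition ann_im t : submodClosed M'' := im_submod g (ann M (J t)).

Lemma ann_im_le n k x : (n <= k)%N -> x \in ann_im n -> x \in ann_im k.
Proof.
move=> nk /im_submodP[y Jy <-]; apply/im_submodP.
by exists y => //; exact: ann_le Jy.
Qed.

Lemma ann_imS t x : x \in ann_im t -> x \in ann_im t.+1.
Proof. exact: ann_im_le. Qed.

Lemma ann_im_ann t x : x \in ann_im t -> x \in ann M'' (J t).
Proof. by move=> /im_submodP[y Jy <-]; exact: ann_map. Qed.

Lemma ann_im_map t x : x \in ann M (J t) -> g x \in ann_im t.
Proof. by move=> Jx; apply/im_submodP; exists x. Qed.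

(** The preimage of 0 :_M'' I^t in [M] is ker g :_M I^t, so [dual_artin_rees] with K = ker g gives
    lifts killed by one power of [I]. *)
Lemma ann_ann_im t : exists2 s, (t <= s)%N &
  forall x, x \in ann M'' (J t) -> x \in ann_im s.
Proof.
have [s hs] := dual_artin_rees (kerl g) I t noethR artM.
exists (maxn s t); first exact: leq_maxr.
have [_ _ g_surj] := fg.
move=> x; have [y <-] := g_surj x => /mk_submodP gy.
have [|z Jz /mk_submodP] := hs y.
  apply/mk_submodP/mk_submodP => a Ja.
  rewrite -linearZ -(linear0 (quot_pi (kerl g))); apply/quot_piP.
  by rewrite subr0; apply/mk_submodP; rewrite linearZ /= gy.
rewrite linearB => /eqP; rewrite subr_eq0 => /eqP ->.
by apply: (@ann_im_le s); [exact: leq_maxl | exact: ann_im_map].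
Qed.

(** Surjectivity is built into [ann_im]; in the middle, injectivity of [f] shows that an element of
    M' is killed by I^t once its image is. *)
Lemma ann_short_exact t :
  short_exact (sub_map (@ann_map R M' M f (J t))) (sub_map (@ann_im_map t)).
Proof.
have [f_inj f_g _] := fg; split.
- move=> x y xy; have fxy := congr1 (incl (ann M (J t))) xy.
  by apply/val_inj/f_inj; exact: fxy.
- move=> y; split=> [y0|[x <-]].
    have /f_g[x fx] : g (val y) = 0 by have gy := congr1 (incl (ann_im t)) y0; exact: gy.
    have Jx : x \in ann M' (J t).
      apply/mk_submodP => a Ja; apply: f_inj; rewrite linearZ /= fx linear0.
      by have /mk_submodP := valP y; apply.
    by exists (exist _ x Jx); apply/val_inj.
  by apply/val_inj; apply/f_g; exists (val x).
move=> z; have /im_submodP[y Jy gy] := valP z.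
by exists (exist _ y Jy); apply/val_inj.
Qed.

Definition im_sys i : dirsys R := filtration_sys ann_imS i.

Definition im_sys_map i t : {linear formal_sys m I i M t -> im_sys i t} :=
  local_homology_map m i (sub_map (@ann_im_map t)).

Lemma im_sys_map_tr i t x :
  im_sys_map i t.+1 (dir_tr (formal_sys m I i M) t x) =
  dir_tr (im_sys i) t (im_sys_map i t x).
Proof. by apply: local_homology_map_square => y; exact: val_inj. Qed.

Definition im_sys_incl i t : {linear im_sys i t -> formal_sys m I i M'' t} :=
  local_homology_map m i (sub_map (f := idfun) (@ann_im_ann t)).

Lemma im_sys_incl_tr i t x :
  im_sys_incl i t.+1 (dir_tr (im_sys i) t x) =
  dir_tr (formal_sys m I i M'') t (im_sys_incl i t x).
Proof. by apply: local_homology_map_square => y; exact: val_inj. Qed.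

Definition im_sys_connecting i t : {linear im_sys i.+1 t -> formal_sys m I i M' t} :=
  local_homology_connecting m (ann_short_exact t) i.

Lemma im_sys_connecting_tr i t x :
  im_sys_connecting i t.+1 (dir_tr (im_sys i.+1) t x) =
  dir_tr (formal_sys m I i M') t (im_sys_connecting i t x).
Proof.
apply/esym.
apply: (local_homology_connecting_nat (ann_short_exact t) (ann_short_exact t.+1)
  (f := ann_incl I M t)) => y; exact: val_inj.
Qed.

(** The inclusions of 0 :_M'' I^t in B_s from [ann_ann_im] supply the reverse maps of an
    interleaving. *)
Lemma im_sys_incl_bij i : injective (dirlim_map (@im_sys_incl_tr i)) /\
  forall v, exists u, dirlim_map (@im_sys_incl_tr i) u = v.
Proof.
apply: dirlim_interleave => t; have [s ts hs] := ann_ann_im t.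
exists s; split=> //; exists (local_homology_map m i (sub_map (f := idfun) hs)).
split=> h.
  have ts' x : x \in ann M'' (J t) -> x \in ann M'' (J s) by exact: ann_le.
  rewrite (@filtration_shift M'' (fun t => ann M'' (J t)) (@ann_powS R I M'')
    i t s ts') //.
  by apply: local_homology_map_comp => x; exact: val_inj.
have ts' x : x \in ann_im t -> x \in ann_im s by exact: ann_im_le.
rewrite (@filtration_shift M'' ann_im ann_imS i t s ts') //.
by apply: local_homology_map_comp => x; exact: val_inj.
Qed.

Lemma im_sys_incl_map i u :
  dirlim_map (@im_sys_incl_tr i) (dirlim_map (@im_sys_map_tr i) u) =
  formal_local_homology_map m I (Posz i) g u.
Proof.
have [t [x <-]] := dirlim_surj u; rewrite !dirlim_mapE.
congr (dir_in _); apply: local_homology_map_comp => y; exact: val_inj.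
Qed.

Let artA (U : lmodType R) t : artinian U -> artinian (submod (ann U (J t))).
Proof. exact: artinian_sub. Qed.

Lemma formal_exact i :
  exact_at (formal_local_homology_map m I (Posz i) f)
           (formal_local_homology_map m I (Posz i) g).
Proof.
have ex : exact_at (formal_local_homology_map m I (Posz i) f)
    (dirlim_map (@im_sys_map_tr i)).
  apply: dirlim_exact => t.
  by apply: (local_homology_exact noethR _ (ann_short_exact t)); exact: artA.
exact: (exact_at_inj (im_sys_incl_bij i).1 (@im_sys_incl_map i) ex).
Qed.

Lemma formal_surj0 v : exists u, formal_local_homology_map m I 0 g u = v.
Proof.
have [w <-] := (im_sys_incl_bij 0).2 v.
have [|u <-] := dirlim_map_surj (@im_sys_map_tr 0) _ w.
  move=> t h; apply: (local_homology_surj0 noethR _ (ann_short_exact t));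
    exact: artA.
by exists u; rewrite -im_sys_incl_map.
Qed.

Lemma formal_connecting_ex i :
  exists d : {linear formal_local_homology m I (Posz i.+1) M'' ->
                     formal_local_homology m I (Posz i) M'},
    exact_at (formal_local_homology_map m I (Posz i.+1) g) d /\
    exact_at d (formal_local_homology_map m I (Posz i) f).
Proof.
have [incl_inj incl_surj] := im_sys_incl_bij i.+1.
apply: (exact_at_bij incl_inj incl_surj (@im_sys_incl_map i.+1)
  (d := dirlim_map (@im_sys_connecting_tr i))).
  apply: dirlim_exact => t.
  by apply: (local_homology_connecting_exact noethR); exact: artA.
apply: dirlim_exact => t.
by apply: (local_homology_exact_connecting noethR); exact: artA.
Qed.

(** Writing i as k + 1 allows a case split on k: nonnegative degrees, the end of the sequence at k =
    -1, and zero modules below. *)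
Lemma formal_long_exact (i k : int) : i = k + 1 ->
  exists d : {linear formal_local_homology m I i M'' -> formal_local_homology m I k M'},
    [/\ exact_at (formal_local_homology_map m I i f)
                 (formal_local_homology_map m I i g),
        exact_at (formal_local_homology_map m I i g) d &
        exact_at d (formal_local_homology_map m I k f)].
Proof.
case: k => [k|[|k]] ->.
- have -> : Posz k + 1 = Posz k.+1 by rewrite -PoszD addn1.
  have [d [gd df]] := formal_connecting_ex k.
  by exists d; split; [exact: (@formal_exact k.+1) | exact: gd | exact: df].
(* The target is the zero module in degree -1, so the connecting map is 0 and exactness before it is
   surjectivity in degree 0. *)
- have -> : Negz 0 + 1 = Posz 0 by [].
  exists \0; split; first exact: (@formal_exact 0).
    by move=> v; split=> _; [exact: (formal_surj0 v) |].
  move=> y; split=> _; last exact: thinmx0.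
  by exists 0; rewrite [LHS]thinmx0 [RHS]thinmx0.
have -> : Negz k.+1 + 1 = Negz k by rewrite !NegzE -addn1 PoszD opprD subrK.
by exists idfun; split=> y; split=> _; first [exact: thinmx0 | exists y].
Qed.

End FormalSequence.

Theorem theorem2p18 (R : comNzRingType) (m I : submodClosed R^o)
    (M' M M'' : lmodType R) (f : {linear M' -> M}) (g : {linear M -> M''})
    (R_noetherian : noetherian_ring R) (R_local : local_ring m)
    (artM' : artinian M') (artM : artinian M) (artM'' : artinian M'')
    (fg_exact : short_exact f g) :
  exists delta : forall i : int,
      {linear formal_local_homology m I i M'' ->
              formal_local_homology m I (i - 1) M'},
    forall i : int,
      [/\ exact_at (formal_local_homology_map m I i f)
                   (formal_local_homology_map m I i g),
          exact_at (formal_local_homology_map m I i g) (delta i) &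
          exact_at (delta i) (formal_local_homology_map m I (i - 1) f)].
Proof.
have ex i := formal_long_exact m I R_noetherian artM' artM fg_exact
  (esym (subrK 1 i)).
by exists (fun i => sval (cid (ex i))) => i; exact: svalP (cid (ex i)).
Qed.
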